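(* Let $P$ be a non-self-intersecting polygon and let $f\in\mathcal R^k_1$ with $k\ge1$. Suppose that $\Sigma$ is an invariant set of $\Phi_f$ with Property (A). Then $\Sigma$ is uniformly hyperbolic.
   Context: Billiard map. Let $P\subset\mathbb R^2$ be the compact region bounded by a non-self-intersecting polygon with vertices $C_1,\dots,C_n$; let $\zeta:[0,|\partial P|]\to\mathbb R^2$ be the positively oriented arclength parametrization of $\partial P$, with $\zeta(\tilde s_i)=C_i$, $0=\tilde s_1<\dots<\tilde s_n<\tilde s_{n+1}=|\partial P|$ and $\zeta(|\partial P|)=\zeta(0)$. Put $M=(0,|\partial P|)\times(-\pi/2,\pi/2)$ and $V=\{\tilde s_1,\dots,\tilde s_{n+1}\}\times(-\pi/2,\pi/2)$. For $x=(s,\theta)\in M\setminus V$ let $q(x)=\zeta(s)$, let $v(x)$ be the unit vector such that the oriented angle from $\zeta'(s)$ to $v(x)$ is $\pi/2-\theta$, let $t(x)=\sup\{\tau>0: (q(x),q(x)+\tau v(x))\subset P\}$ (open segment), and $q_1(x)=q(x)+t(x)v(x)$. Let $S_1^+=\bigcup_i\overline{q_1^{-1}(C_i)}$ and $N_1^+=\partial M\cup V\cup S_1^+$. For $x\in M\setminus N_1^+$ let $s_1(x)=\zeta^{-1}(q_1(x))$, $\bar v_1(x)=-v(x)+2\langle\zeta'(s_1(x)),v(x)\rangle\zeta'(s_1(x))$ and $\bar\theta_1(x)=\arcsin\langle\zeta'(s_1(x)),\bar v_1(x)\rangle$. For a reflection law $f:(-\pi/2,\pi/2)\to(-\pi/2,\pi/2)$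 the billiard map is $\Phi_f:M\setminus N_1^+\to M$, $\Phi_f(x)=(s_1(x),f(\bar\theta_1(x)))$. Elements of $M$ are called collisions; the collision $(s,\theta)$ occurs at the side of $P$ containing $\zeta(s)$. Reflection laws. For differentiable $f$ on $(-\pi/2,\pi/2)$ let $\lambda(f)=\sup|f'|$. $\mathcal R$ is the set of differentiable $f:(-\pi/2,\pi/2)\to\mathbb R$ with $f(0)=0$ and $\lambda(f)<\infty$, and $\mathcal R_1^k$ is the set of $f\in\mathcal R$ that are $C^k$ embeddings with $\lambda(f)<1$. Let $N_{n+1}^+=N_n^+\cup\Phi_f^{-1}(N_n^+)$, $N_\infty^+=\bigcup_{n\ge1}N_n^+$, $D_f=\bigcap_{n\ge0}\Phi_f^n(M\setminus N_\infty^+)$. A set $\Sigma\subset M$ is invariant if $\Sigma\subset D_f$ and $\Phi_f^{-1}(\Sigma)=\Sigma$, and forward invariant if $\Sigma\subset D_f$ and $\Phi_f(\Sigma)\subset\Sigma$. Property (A): a forward invariant set $\Omega$ has Property (A) if there exists $m>0$ such that every sequence of consecutive collisions (i.e. orbit segment of $\Phi_f$) between parallel sides of $P$ contained in $\Omega$ consists of no more than $m$ collisions. With the Euclidean norm in the coordinates $(s,\theta)$ and $\Phi=\Phi_f$, an invariant set $\Sigma$ is uniformly hyperbolic if there are a non-trivial continuous ($D\Phi$-invariant) splitting $T_\Sigma M=E\oplus F$ and constants $0<\mu<1$, $A>0$ with $\|D\Phi^n|_{E(x)}\|\le A\mu^n$ and $\|D\Phi^{-n}|_{F(\Phi^nx)}\|\le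 A\mu^n$ for all $x\in\Sigma$, $n\ge1$.
   Formalization: The flight time t(x) is taken with open segments in the interior of P instead of the compact region P, so trajectories grazing a vertex are singular; with the closed region, Φ_f is discontinuous at grazing points outside N_1^+, where DΦ_f is undefined. *)

(* Defs.v *)
From HB Require Import structures.
From mathcomp Require Import all_boot all_order all_algebra.
From mathcomp Require Import all_classical all_reals all_analysis.

Set Implicit Arguments.
Unset Strict Implicit.
Unset Printing Implicit Defensive.

Import Order.TTheory GRing.Theory Num.Theory.
Import numFieldNormedType.Exports.

Local Open Scope classical_set_scope.
Local Open Scope ring_scope.

(** * The Euclidean plane *)

(* The library norm on ['rV[R]_2] is the sup norm: it is used only for the
   topology and for differentials; lengths are measured by [enorm]. *)
Notation plane R := 'rV[R]_2.

Definition pt {R : realType} (a b : R) : plane R :=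
  \row_j (if j == 0 then a else b).

Definition xco {R : realType} (z : plane R) : R := z 0 0.
Definition yco {R : realType} (z : plane R) : R := z 0 1.

Definition dotp {R : realType} (u v : plane R) : R :=
  xco u * xco v + yco u * yco v.

Definition enorm {R : realType} (u : plane R) : R := Num.sqrt (dotp u u).

(* Rotation by the oriented angle [a]. *)
Definition rotate {R : realType} (a : R) (u : plane R) : plane R :=
  pt (cos a * xco u - sin a * yco u) (sin a * xco u + cos a * yco u).

(** * Polygons

   The vertices are [C i] for [i : 'I_n]; the side [i] joins [C i] to
   [C (ordS i)], where [ordS] is the cyclic successor. *)

Section Polygon.
Context {R : realType} {n : nat} (C : 'I_n -> plane R).

Definition side_vec (i : 'I_n) : plane R := C (ordS i) - C i.
Definition side_len (i : 'I_n) : R := enorm (side_vec i).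
Definition side (i : 'I_n) : set (plane R) :=
  [set C i + r *: side_vec i | r in `[0, 1]].

(* Indices start at 0: [brk k] is the arclength parameter of the vertex [C k],
   and [brk n] is the perimeter. *)
Definition brk (k : nat) : R := \sum_(j < n | (j < k)%N) side_len j.
Definition perimeter : R := brk n.
Definition is_brk (s : R) : Prop := exists2 k, (k <= n)%N & s = brk k.

(* Arclength parametrization of the boundary, meaningful on [0, perimeter];
   at a breakpoint the two admissible indices give the same point. *)
Definition zeta (s : R) : plane R :=
  if [pick i : 'I_n | brk i <= s <= brk i.+1] is Some i
  then C i + ((s - brk i) / side_len i) *: side_vec i else 0.

Definition simple_polygon : Prop :=
  [/\ (3 <= n)%N,
      forall i, C (ordS i) != C i
    & {in `[0, perimeter[ &, injective zeta}].

Definition poly_boundary : set (plane R) := \bigcup_i side i.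

(* The compact region bounded by the polygon: the polygonal curve together with
   the bounded connected components of its complement. *)
Definition poly_region : set (plane R) :=
  poly_boundary `|`
  [set z | ~ poly_boundary z /\
           bounded_set (connected_component (~` poly_boundary) z)].

Definition poly_interior : set (plane R) := poly_region `\` poly_boundary.

(* The interior lies on the left of the boundary. *)
Definition positively_oriented : Prop :=
  forall s, 0 < s < perimeter -> ~ is_brk s ->
  \forall e \near 0^'+,
    poly_interior (zeta s + e *: rotate (pi / 2) (derive1 zeta s)).

Definition parallel_sides (i j : 'I_n) : Prop :=
  exists c : R, side_vec i = c *: side_vec j.

End Polygon.

(** * Reflection laws

   A law is a total function of which only the restriction to
   [(- pi / 2, pi / 2)] matters. *)

Section ReflectionLaw.
Context {R : realType}.

Definition angles : set R := `](- (pi / 2)), (pi / 2)[.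

Definition lambda (f : R -> R) : \bar R :=
  ereal_sup [set (`|derive1 f a|)%:E | a in angles].

Definition reflection_law (f : R -> R) : Prop :=
  [/\ forall a, angles a -> derivable f a 1, f 0 = 0 & (lambda f < +oo)%E].

Definition Ck_on_angles (k : nat) (f : R -> R) : Prop :=
  (forall j a, (j < k)%N -> angles a -> derivable (derive1n j f) a 1) /\
  (forall j a, (j <= k)%N -> angles a -> {for a, continuous (derive1n j f)}).

(* C^k, immersive, and a homeomorphism onto its image. *)
Definition Ck_embedding (k : nat) (f : R -> R) : Prop :=
  [/\ Ck_on_angles k f,
      forall a, angles a -> derive1 f a != 0
    & exists g : R -> R, (forall a, angles a -> g (f a) = a) /\
        {within f @` angles, continuous g}].

Definition contracting_law (k : nat) (f : R -> R) : Prop :=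
  [/\ reflection_law f, Ck_embedding k f & (lambda f < 1)%E].

End ReflectionLaw.

(** * The billiard map

   A point of the phase space is [x = pt s theta]. All maps are total functions,
   meaningful on the domains stated by the sets below. *)

Section Billiard.
Context {R : realType} {n : nat} (C : 'I_n -> plane R).

Definition phase : set (plane R) :=
  [set x | 0 < xco x < perimeter C /\ angles (yco x)].

Definition phase_bd : set (plane R) := closure phase `\` interior phase.

Definition vertex_lines : set (plane R) :=
  [set x | is_brk C (xco x) /\ angles (yco x)].

Definition bq (x : plane R) : plane R := zeta C (xco x).

Definition bv (x : plane R) : plane R :=
  rotate (pi / 2 - yco x) (derive1 (zeta C) (xco x)).

(* The open segment must lie in the polygon without its boundary, so that the
   flight ends at the first boundary point it meets; trajectories grazing a
   vertex are thereby singular (they belong to [sing1]). *)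
Definition bt (x : plane R) : R :=
  sup [set tau | 0 < tau /\
    [set bq x + r *: bv x | r in `]0, tau[] `<=` poly_interior C].

Definition bq1 (x : plane R) : plane R := bq x + bt x *: bv x.

Definition sing1 : set (plane R) :=
  \bigcup_i closure ((phase `\` vertex_lines) `&` bq1 @^-1` [set C i]).

Definition N1 : set (plane R) := phase_bd `|` vertex_lines `|` sing1.

Definition bs1 (x : plane R) : R :=
  get [set s | 0 <= s <= perimeter C /\ zeta C s = bq1 x].

Definition tangent1 (x : plane R) : plane R := derive1 (zeta C) (bs1 x).

Definition bv1 (x : plane R) : plane R :=
  - bv x + (2 * dotp (tangent1 x) (bv x)) *: tangent1 x.

Definition btheta1 (x : plane R) : R := asin (dotp (tangent1 x) (bv1 x)).

Variable f : R -> R.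

Definition billiard (x : plane R) : plane R := pt (bs1 x) (f (btheta1 x)).

Definition billiard_dom : set (plane R) := phase `\` N1.

Definition billiard_preimage (A : set (plane R)) : set (plane R) :=
  billiard_dom `&` billiard @^-1` A.

(* [sing m] is N_m^+, for m >= 1. *)
Definition sing (m : nat) : set (plane R) :=
  iter m.-1 (fun A => A `|` billiard_preimage A) N1.

Definition sing_infty : set (plane R) := \bigcup_(m in [set m | (1 <= m)%N]) sing m.

Definition billiard_core : set (plane R) :=
  \bigcap_m (iter m billiard @` (phase `\` sing_infty)).

Definition billiard_invariant (S : set (plane R)) : Prop :=
  S `<=` billiard_core /\ billiard_preimage S = S.

Definition billiard_forward_invariant (S : set (plane R)) : Prop :=
  S `<=` billiard_core /\ billiard @` S `<=` S.

Definition collides_at (x : plane R) (i : 'I_n) : Prop := side C i (bq x).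

(* The [l] collisions [x, ..., billiard^(l-1) x] all belong to [S], and any two
   consecutive ones occur at parallel sides. *)
Definition parallel_collisions (S : set (plane R)) (x : plane R) (l : nat) : Prop :=
  (forall j, (j < l)%N -> S (iter j billiard x)) /\
  (forall j, (j.+1 < l)%N -> exists i i' : 'I_n,
     [/\ collides_at (iter j billiard x) i,
         collides_at (iter j.+1 billiard x) i'
       & parallel_sides C i i']).

Definition property_A (S : set (plane R)) : Prop :=
  billiard_forward_invariant S /\
  exists2 m : nat, (0 < m)%N &
    forall x l, parallel_collisions S x l -> (l <= m)%N.

End Billiard.

(** * Uniform hyperbolicity *)

Section Hyperbolicity.
Context {R : realType}.

Definition Diff (g : plane R -> plane R) (x : plane R) : 'End(plane R) :=
  linfun ('d g x).

(* Continuity over [S] of a field of lines: locally it is spanned by a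
   continuous nonvanishing vector field. *)
Definition continuous_line_field (S : set (plane R))
    (E : plane R -> {vspace plane R}) : Prop :=
  forall x, S x -> exists (U : set (plane R)) (e : plane R -> plane R),
    [/\ open U, U x, {within U `&` S, continuous e}
      & forall y, (U `&` S) y -> e y != 0 /\ E y = <[e y]>%VS].

(* Since the plane has dimension 2, a splitting is non-trivial exactly when both
   summands are lines, which [continuous_line_field] also records. *)
Definition continuous_splitting (S : set (plane R))
    (E F : plane R -> {vspace plane R}) : Prop :=
  [/\ forall x, S x -> E x != 0%VS /\ F x != 0%VS,
      forall x, S x -> (E x + F x)%VS = fullv /\ (E x :&: F x)%VS = 0%VS,
      continuous_line_field S E
    & continuous_line_field S F].

Definition uniformly_hyperbolic (Phi : plane R -> plane R) (S : set (plane R)) :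
    Prop :=
  (forall x, S x -> differentiable Phi x /\ lker (Diff Phi x) = 0%VS) /\
  exists E F : plane R -> {vspace plane R},
  [/\ continuous_splitting S E F,
      forall x, S x -> (Diff Phi x @: E x)%VS = E (Phi x) /\
                       (Diff Phi x @: F x)%VS = F (Phi x)
    & exists mu A : R, [/\ 0 < mu < 1, 0 < A
      & forall x m, S x -> (1 <= m)%N ->
        (forall u, u \in E x ->
           enorm (Diff (iter m Phi) x u) <= A * mu ^+ m * enorm u) /\
        (forall w, w \in F (iter m Phi x) ->
           enorm ((Diff (iter m Phi) x)^-1%VF w) <= A * mu ^+ m * enorm w)]].

End Hyperbolicity.

(* Main.v *)
Require Import Defs.
From HB Require Import structures.
From mathcomp Require Import all_boot all_order all_algebra.
From mathcomp Require Import all_classical all_reals all_analysis.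
From mathcomp Require Import ring lra.

(** In the coordinates [(s, theta)] the differential of the billiard map is upper
    triangular. If a flight leaves a side at the angle [theta], lasts a time [t], and
    arrives at the angle [theta'], before reflection, then, up to signs,
      [ds1 = (cos theta ds + t dtheta) / cos theta'],  [dtheta1 = f' theta' dtheta].
    The horizontal lines are therefore invariant, and the action on the quotient is a
    contraction, as [`|f'| <= L < 1].

    Horizontal vectors are expanded. Along an orbit the product of the factors
    [cos theta / cos theta'] is a ratio of two cosines times the product of the ratios
    [cos (f theta') / cos theta'], one for each reflection ([prod_horizontal]). The
    angles of the collisions of an invariant set are values of [f], so their cosines
    are at least [cos (L * (pi / 2))]. Each of the ratios is at least 1, as [f] brings
    angles closer to 0, and exceeds 1 by a fixed amount if [theta'] is bounded away
    from 0 ([cos_gain]). On a flight between sides that are not parallel, the angles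
    at both ends cannot be simultaneously small, so that one of the two reflections
    has a definite gain; property A bounds the time to wait for such a flight. Hence
    the expansion is exponential ([horizontal_growth]).

    A contracted invariant line field, transverse to the horizontal one, is then found
    as a graph over the vertical direction: its slope is the sum of a series along the
    forward orbit, dominated by a geometric series of ratio [L]. Each term is
    continuous, since the differential of the map is, so the slope is continuous and
    bounded on the invariant set. This part uses nothing of billiards
    ([triangular_hyperbolic]).

    The formula for the differential is a matter of planar topology: off the singular
    set the sides on which a flight starts and ends are locally constant. The flight is
    a segment in the interior of the polygon joining interior points of two sides and
    transverse to both; by compactness it stays away from the other sides, and so do
    its neighbours, which remain in the same component of the complement of the boundary
    ([flight_near]). The landing point is then an explicit rational function of the
    sine and cosine of the angle ([is_diff_billiard]). *)

Set Implicit Arguments.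
Unset Strict Implicit.
Unset Printing Implicit Defensive.

Import Order.TTheory GRing.Theory Num.Theory.
Import numFieldNormedType.Exports.

Local Open Scope classical_set_scope.
Local Open Scope ring_scope.

(** * Coordinates of the plane *)

Section Plane.
Context {R : realType}.
Implicit Types u v w z : plane R.

Lemma xco_pt (a b : R) : xco (pt a b) = a. Proof. by rewrite /xco mxE. Qed.
Lemma yco_pt (a b : R) : yco (pt a b) = b. Proof. by rewrite /yco mxE. Qed.
Lemma xcoD u v : xco (u + v) = xco u + xco v. Proof. by rewrite /xco mxE. Qed.
Lemma ycoD u v : yco (u + v) = yco u + yco v. Proof. by rewrite /yco mxE. Qed.
Lemma xcoN u : xco (- u) = - xco u. Proof. by rewrite /xco mxE. Qed.
Lemma ycoN u : yco (- u) = - yco u. Proof. by rewrite /yco mxE. Qed.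
Lemma xcoZ (a : R) u : xco (a *: u) = a * xco u. Proof. by rewrite /xco mxE. Qed.
Lemma ycoZ (a : R) u : yco (a *: u) = a * yco u. Proof. by rewrite /yco mxE. Qed.
Lemma xco0 : xco (0 : plane R) = 0. Proof. by rewrite /xco mxE. Qed.
Lemma yco0 : yco (0 : plane R) = 0. Proof. by rewrite /yco mxE. Qed.

Definition coE :=
  (xco_pt, yco_pt, xcoD, ycoD, xcoN, ycoN, xcoZ, ycoZ, xco0, yco0).

Lemma planeP u v : xco u = xco v -> yco u = yco v -> u = v.
Proof.
rewrite /xco /yco => hx hy; apply/rowP => j.
have [->//|j0] := eqVneq j 0.
suff -> : j = 1 by [].
by apply/val_inj; case: j j0 => -[|[|m]].
Qed.

(** The inner normal, when [u] is the tangent of a positively oriented boundary. *)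
Definition perp u : plane R := pt (- yco u) (xco u).

Lemma rotate_pihalf u : rotate (pi / 2) u = perp u.
Proof.
by apply: planeP; rewrite /rotate !coE cos_pihalf sin_pihalf; ring.
Qed.

Lemma continuous_xco : continuous (@xco R).
Proof. exact: coord_continuous. Qed.
Lemma continuous_yco : continuous (@yco R).
Proof. exact: coord_continuous. Qed.

Lemma pt_decomp (a b : R) : pt a b = a *: pt 1 0 + b *: pt 0 1.
Proof. by apply: planeP; rewrite !coE; ring. Qed.

Lemma cvg_pt (T : Type) (F : set_system T) {FF : Filter F} (a b : T -> R) (x y : R) :
  a @ F --> x -> b @ F --> y -> (fun t => pt (a t) (b t)) @ F --> pt x y.
Proof.
move=> ha hb; rewrite (pt_decomp x y).
under eq_fun do rewrite pt_decomp.
by apply: cvgD; apply: cvgZr_tmp.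
Qed.

Lemma cvg_xco (T : Type) (F : set_system T) (a : T -> plane R) u :
  a @ F --> u -> (fun t => xco (a t)) @ F --> xco u.
Proof. by move=> ha; apply: (cvg_comp a xco ha); exact: continuous_xco. Qed.

Lemma cvg_yco (T : Type) (F : set_system T) (a : T -> plane R) u :
  a @ F --> u -> (fun t => yco (a t)) @ F --> yco u.
Proof. by move=> ha; apply: (cvg_comp a yco ha); exact: continuous_yco. Qed.

Lemma cvg_dotp (T : Type) (F : set_system T) {FF : Filter F} (a b : T -> plane R)
    u v :
  a @ F --> u -> b @ F --> v -> (fun t => dotp (a t) (b t)) @ F --> dotp u v.
Proof.
by move=> ha hb; rewrite /dotp; apply: cvgD; apply: cvgM;
  do ?[exact: cvg_xco | exact: cvg_yco].
Qed.

Lemma convex_lt (a b e p : R) : a < e -> b < e -> 0 <= p <= 1 ->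
  (1 - p) * a + p * b < e.
Proof.
move=> ae be /andP[p0 p1].
have h1 : 0 <= (1 - p) * (e - a) by rewrite mulr_ge0 ?subr_ge0// ltW.
have [->|pn0] := eqVneq p 0; first by rewrite subr0 mul1r mul0r addr0.
have h2 : 0 < p * (e - b) by rewrite mulr_gt0 ?subr_gt0// lt_neqAle eq_sym pn0.
lra.
Qed.

Lemma coord_le_norm (i : 'I_2) u : `|u 0 i| <= `|u|.
Proof.
rewrite [`|u|]mx_normrE.
by apply: (le_bigmax _ (fun ij => `|u ij.1 ij.2|) (0, i)).
Qed.

Lemma norm_xco u : `|xco u| <= `|u|. Proof. exact: coord_le_norm. Qed.
Lemma norm_yco u : `|yco u| <= `|u|. Proof. exact: coord_le_norm. Qed.
End Plane.

(** * The arclength parametrization *)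

Section Arclength.
Context {R : realType} {n : nat} (C : 'I_n -> plane R).
Hypothesis hC : simple_polygon C.
Implicit Types (i j : 'I_n) (s : R) (z : plane R).

Lemma dotp_gt0 (u : plane R) : u != 0 -> 0 < dotp u u.
Proof.
move=> u0; rewrite /dotp -!expr2 lt_neqAle addr_ge0 ?sqr_ge0// andbT eq_sym.
apply: contra u0; rewrite paddr_eq0 ?sqr_ge0// !sqrf_eq0 => /andP[/eqP hx /eqP hy].
by apply/eqP/planeP; rewrite coE.
Qed.

Lemma side_len_gt0 i : 0 < side_len C i.
Proof.
have [_ hv _] := hC; rewrite /side_len /enorm sqrtr_gt0; apply: dotp_gt0.
by rewrite /side_vec subr_eq0.
Qed.

Lemma brk0 : brk C 0 = 0.
Proof. by rewrite /brk big_pred0. Qed.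

Lemma brkS i : brk C i.+1 = brk C i + side_len C i.
Proof.
rewrite /brk (bigD1 i)//= addrC; congr (_ + _).
by apply: eq_bigl => j; rewrite ltnS ltn_neqAle andbC.
Qed.

Lemma brk_ltS i : brk C i < brk C i.+1.
Proof. by rewrite brkS ltrDl side_len_gt0. Qed.

Lemma brk_le (k l : nat) : (k <= l)%N -> brk C k <= brk C l.
Proof.
move=> kl; rewrite /brk big_mkcond [leRHS]big_mkcond; apply: ler_sum => i _.
have := ltW (side_len_gt0 i).
by case: ltnP => // ik; rewrite ?(leq_trans ik kl)//; case: ifP.
Qed.

Lemma brk_lt_index i j (s : R) : brk C i <= s -> s < brk C j.+1 -> (i <= j)%N.
Proof.
move=> h1 h2; rewrite leqNgt; apply/negP => /brk_le; apply/negP.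
by rewrite -ltNge (le_lt_trans h1).
Qed.

Definition tang i : plane R := (side_len C i)^-1 *: side_vec C i.

Lemma dotp_tang i : dotp (tang i) (tang i) = 1.
Proof.
have l0 := side_len_gt0 i.
have : side_len C i ^+ 2 = dotp (side_vec C i) (side_vec C i).
  by rewrite /side_len /enorm sqr_sqrtr// /dotp -!expr2 addr_ge0// sqr_ge0.
move=> e; transitivity (dotp (side_vec C i) (side_vec C i) / side_len C i ^+ 2).
  by rewrite /dotp /tang !coE; field; rewrite gt_eqF.
by rewrite -e divff// sqrf_eq0 gt_eqF.
Qed.

Lemma side_vecE i : side_vec C i = side_len C i *: tang i.
Proof. by rewrite /tang scalerA divff ?scale1r// gt_eqF// side_len_gt0. Qed.

Definition side_at i s : plane R := C i + (s - brk C i) *: tang i.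

Lemma side_at_brk i : side_at i (brk C i) = C i.
Proof. by rewrite /side_at subrr scale0r addr0. Qed.

Lemma side_at_brkS i : side_at i (brk C i.+1) = C (ordS i).
Proof.
by rewrite /side_at brkS addrAC subrr add0r -side_vecE /side_vec addrC subrK.
Qed.

Lemma zetaE i s : brk C i <= s <= brk C i.+1 -> zeta C s = side_at i s.
Proof.
move=> /andP[h1 h2]; rewrite /zeta; case: pickP => [j /andP[h3 h4]|/(_ i)]; last first.
  by rewrite h1 h2.
have -> : C j + ((s - brk C j) / side_len C j) *: side_vec C j = side_at j s.
  by rewrite /side_at /tang scalerA.
(* two closed parameter intervals meet only at a common breakpoint *)
have key (a b : 'I_n) : (a < b)%N -> s <= brk C a.+1 -> brk C b <= s ->
    side_at a s = side_at b s.
  move=> ab ha hb.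
  have eab : b = a.+1 :> nat.
    apply/eqP; rewrite eqn_leq ab andbT leqNgt; apply/negP => lt.
    have a1n : (a.+1 < n)%N := ltn_trans lt (ltn_ord b).
    have := brk_le lt; have := brk_ltS (Ordinal a1n) => /=; lra.
  have es : s = brk C b by have := hb; move: ha; rewrite -eab; lra.
  rewrite es side_at_brk -[in LHS](_ : a.+1 = b) // side_at_brkS; congr (C _).
  by apply: val_inj; rewrite /= modn_small -eab.
have [ij|ji|/val_inj->//] := ltngtP i j; first exact/esym/key.
exact: key.
Qed.

Lemma brk_locate s : 0 <= s <= perimeter C ->
  exists i, brk C i <= s <= brk C i.+1.
Proof.
have [n3 _ _] := hC; have n0 : (0 < n)%N by apply: leq_trans n3.
move=> /andP[s0 sp].
have exP : exists k, (k < n)%N && (brk C k <= s).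
  by exists 0; rewrite n0 brk0.
have ub k : (k < n)%N && (brk C k <= s) -> (k <= n)%N by move=> /andP[/ltnW].
case: (ex_maxnP exP ub) => k /andP[kn hk] kmax.
exists (Ordinal kn); rewrite /= hk /=.
have [kn1|] := ltnP k.+1 n; last first.
  by move=> nk; apply: (le_trans sp); apply: brk_le.
rewrite leNgt; apply/negP => h.
by have := kmax k.+1; rewrite kn1 ltW// ltnn => /(_ isT).
Qed.

Lemma brk_locate_open s : 0 < s < perimeter C -> ~ is_brk C s ->
  exists i, brk C i < s < brk C i.+1.
Proof.
move=> /andP[s0 sp] nb.
have [|i /andP[h1 h2]] := @brk_locate s; first by rewrite !ltW.
exists i; rewrite !lt_neqAle h1 h2 !andbT.
apply/andP; split; apply/eqP => e; apply: nb.
  exists (nat_of_ord i); first exact: (ltnW (ltn_ord i)).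
  exact: (esym e).
by exists i.+1; first exact: ltn_ord.
Qed.

Lemma brk_open_itv i s : brk C i < s < brk C i.+1 -> 0 < s < perimeter C.
Proof.
move=> /andP[h1 h2]; rewrite (le_lt_trans _ h1) -?brk0 ?brk_le//=.
by rewrite (lt_le_trans h2)// brk_le.
Qed.

Lemma sideP i z : side C i z <->
  exists2 s, brk C i <= s <= brk C i.+1 & z = side_at i s.
Proof.
have l0 := side_len_gt0 i; split.
  case=> r; rewrite /= in_itv /= => /andP[r0 r1] <-.
  exists (brk C i + r * side_len C i).
    rewrite brkS lerDl lerD2l mulr_ge0 ?(ltW l0)//=.
    by rewrite ler_piMl ?(ltW l0).
  by rewrite /side_at side_vecE scalerA addrAC subrr add0r.
case=> s; rewrite brkS => /andP[h1 h2] ->.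
exists ((s - brk C i) / side_len C i) => /=.
  by rewrite in_itv /= divr_ge0 ?subr_ge0 ?(ltW l0)//= ler_pdivrMr// mul1r lerBlDl.
by rewrite side_vecE scalerA /side_at mulrAC -mulrA divff ?mulr1// gt_eqF.
Qed.

Lemma zeta_perimeter : zeta C (perimeter C) = zeta C 0.
Proof.
have [n3 _ _] := hC; have n0 : (0 < n)%N by apply: leq_trans n3.
have n1 : (n.-1 < n)%N by rewrite prednK.
have en : (Ordinal n1).+1 = n by rewrite /= prednK.
rewrite (@zetaE (Ordinal n1)); last first.
  by rewrite /perimeter en lexx brk_le//= leq_pred.
rewrite (@zetaE (Ordinal n0)); last first.
  by rewrite -brk0 lexx ltW// (brk_ltS (Ordinal n0)).
rewrite -[in RHS]brk0 (side_at_brk (Ordinal n0)).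
rewrite /perimeter (_ : brk C n = brk C (Ordinal n1).+1); last by rewrite en.
rewrite side_at_brkS; congr (C _).
by apply: val_inj; rewrite /= prednK// modnn.
Qed.

(** Simplicity speaks of the half-open parameter interval; the remaining parameter,
    the perimeter, has the same image as 0, which lies inside no side. *)
Lemma zeta_inj_open i s s' : brk C i < s < brk C i.+1 ->
  0 <= s' <= perimeter C -> zeta C s' = zeta C s -> s' = s.
Proof.
move=> hs /andP[s0 sp] e; have /andP[t0 tp] := brk_open_itv hs.
have [_ _ inj] := hC.
move: sp; rewrite le_eqVlt => /predU1P[sp|sp].
  suff : 0 = s by move=> s00; rewrite -s00 ltxx in t0.
  apply: inj.
  - by rewrite in_itv/= lexx (lt_trans t0).
  - by rewrite in_itv/= tp (ltW t0).
  by rewrite -zeta_perimeter -sp.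
by apply: inj => //; rewrite in_itv/= ?s0 ?sp ?(ltW t0).
Qed.

(** Both sides are parametrized by [zeta], a common point has a single parameter,
    and the parameter of an interior point determines its side. *)
Lemma side_open_unique i j s : brk C i < s < brk C i.+1 ->
  side C j (side_at i s) -> j = i.
Proof.
move=> hs /sideP[s' hs' e]; have /andP[h1 h2] := hs; have /andP[h3 h4] := hs'.
rewrite -!zetaE ?(ltW h1) ?(ltW h2)// in e.
have es : s' = s.
  apply: (zeta_inj_open hs) => //.
  by rewrite (le_trans _ h3) -?brk0 ?brk_le//= (le_trans h4)// brk_le.
rewrite es in h3 h4.
apply/val_inj/eqP; rewrite eqn_leq; apply/andP; split.
  exact: brk_lt_index h3 h2.
have [//|ji] := leqP i j.
by have := brk_le ji; lra.
Qed.

Lemma mem_side i s : brk C i <= s <= brk C i.+1 -> side C i (side_at i s).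
Proof. by move=> hs; apply/sideP; exists s. Qed.

Lemma derive1_zeta i s : brk C i < s < brk C i.+1 -> derive1 (zeta C) s = tang i.
Proof.
move=> hs; have [h1 h2] := andP hs.
have nr : \forall t \near s, side_at i t = zeta C t.
  near=> t; rewrite (@zetaE i)//; apply/andP; split; apply: ltW; near: t.
    exact: (cvgr_gt s cvg_id _ h1).
  exact: (cvgr_lt s cvg_id _ h2).
rewrite derive1E -(near_eq_derive _ nr).
have H : is_derive s 1 (side_at i) (tang i).
  have -> : side_at i = cst (C i - brk C i *: tang i) + (fun t => t *: tang i).
    by apply/funext => t; rewrite /side_at !fctE scalerBl addrA addrAC.
  have H : is_derive s 1 (fun t : R => t *: tang i) (tang i).
    have [df ed] := is_diff_scalel s (tang i).
    apply: DeriveDef; first exact: diff_derivable.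
    by rewrite deriveE// ed scale1r.
  by have := is_deriveD (is_derive_cst (C i - brk C i *: tang i) s 1) H; rewrite add0r.
by rewrite derive_val.
Unshelve. all: by end_near. Qed.

End Arclength.

(** * The region bounded by the polygon *)

Section Region.
Context {R : realType} {n : nat} (C : 'I_n -> plane R).
Implicit Types (i j : 'I_n) (r s : R) (z y : plane R).

Local Notation bd := (poly_boundary C).
Local Notation inside := (poly_interior C).

Lemma interiorP z :
  inside z <-> ~ bd z /\ bounded_set (connected_component (~` bd) z).
Proof.
split=> [[[//|h] _]//|[h1 h2]].
by split => //; right.
Qed.

Lemma side_compact i : compact (side C i).
Proof.
apply: continuous_compact; last exact: segment_compact.
apply: continuous_subspaceT => r.
by apply: cvgD; [exact: cvg_cst | exact: cvgZr_tmp].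
Qed.

Lemma side_closed i : closed (side C i).
Proof. have H : hausdorff_space (plane R) by exact: norm_hausdorff.
exact: (compact_closed H (@side_compact i)). Qed.

Lemma boundary_closed : closed bd.
Proof. by apply: closed_bigcup => [|i _]; [exact: finite_finset | exact: side_closed]. Qed.

Lemma boundary_bounded : exists2 M, 0 < M & forall z, bd z -> `|z| <= M.
Proof.
exists (1 + \sum_i (`|C i| + `|side_vec C i|)).
  by rewrite ltr_pwDl// sumr_ge0// => i _; rewrite addr_ge0.
move=> z [i _ [r]]; rewrite /= in_itv /= => /andP[r0 r1] <-.
rewrite (bigD1 i)//= ler_wpDl// ler_wpDr//; first by apply: sumr_ge0 => *; rewrite addr_ge0.
rewrite (le_trans (ler_normD _ _))// lerD2l normrZ ger0_norm//.
by rewrite ler_piMl.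
Qed.

(** The interior is a union of components of the complement of the boundary, so
    that membership propagates along connected sets. *)
Lemma connected_interior (A : set (plane R)) z : connected A -> A `<=` ~` bd ->
  A z -> inside z -> A `<=` inside.
Proof.
move=> cA Abd Az /interiorP[bz Bz] y Ay; apply/interiorP; split; first exact: Abd.
rewrite -(@same_connected_component _ _ z y)//.
exact: (connected_component_max Az).
Qed.

Lemma segment_interior z y : inside z ->
  (forall r, 0 <= r <= 1 -> ~ bd (z + r *: (y - z))) -> inside y.
Proof.
move=> iz h; pose g r : plane R := z + r *: (y - z).
apply: (@connected_interior (g @` `[0, 1]) z) => //.
- apply: connected_continuous_connected; first exact: segment_connected.
  apply: continuous_subspaceT => r.
  by apply: cvgD; [exact: cvg_cst | exact: cvgZr_tmp].
- by move=> y' [r hr <-]; apply: h; move: hr; rewrite /= in_itv.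
- by exists 0; rewrite /g /= ?in_itv/= ?lexx ?ler01// scale0r addr0.
- by exists 1; rewrite /g /= ?in_itv/= ?lexx ?ler01// scale1r addrC subrK.
Qed.

Lemma ball_interior z e : 0 < e -> (forall y, `|z - y| < e -> ~ bd y) ->
  forall y y', `|z - y| < e -> `|z - y'| < e -> inside y -> inside y'.
Proof.
move=> e0 h y y' hy hy' iy; apply: (segment_interior iy) => r /andP[r0 r1].
apply: h.
have -> : z - (y + r *: (y' - y)) = (1 - r) *: (z - y) + r *: (z - y').
  by apply: planeP; rewrite !coE; ring.
rewrite (le_lt_trans (ler_normD _ _))// !normrZ !ger0_norm ?subr_ge0//.
by apply: convex_lt; rewrite ?r0.
Qed.

Lemma off_boundary_ball z : ~ bd z ->
  exists2 e, 0 < e & forall y, `|z - y| < e -> ~ bd y.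
Proof.
move=> bz; have : nbhs z (~` bd).
  by apply: open_nbhs_nbhs; split => //; exact/closed_openC/boundary_closed.
by case/nbhs_normP => e /= e0 he; exists e => // y hy; exact: he.
Qed.

Lemma interior_open z : inside z -> \forall y \near z, inside y.
Proof.
move=> iz; have [bz _] := (interiorP z).1 iz.
have [e e0 he] := off_boundary_ball bz.
apply/nbhs_normP; exists e => //= y hy.
by apply: (ball_interior e0 he _ hy iz); rewrite subrr normr0.
Qed.

(** Outside the boundary the region is also closed, so that a flight leaving the
    interior does so through a boundary point. *)
Lemma interior_adherent z : ~ bd z ->
  (forall e, 0 < e -> exists2 y, `|z - y| < e & inside y) -> inside z.
Proof.
move=> bz hz; have [e e0 he] := off_boundary_ball bz.
have [y hy iy] := hz _ e0.
by apply: (ball_interior e0 he hy _ iy); rewrite subrr normr0.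
Qed.

(** From a point far away a ray escapes to infinity without meeting the boundary:
    its component is unbounded. *)
Lemma interior_bounded : exists2 M, 0 < M & forall z, inside z -> `|z| <= M.
Proof.
have [M M0 hM] := boundary_bounded; exists M => // z iz; rewrite leNgt; apply/negP => Mz.
have [bz [N [_ hN]]] := (interiorP z).1 iz.
pose g r : plane R := r *: z.
have sub : g @` `[1, +oo[ `<=` connected_component (~` bd) z.
  apply: connected_component_max.
  - by exists 1; rewrite /g /= ?in_itv/= ?lexx// scale1r.
  - move=> y [r hr <-] /hM; apply/negP.
    have r1 : 1 <= r by move: hr; rewrite /= in_itv /= andbT.
    rewrite -ltNge normrZ ger0_norm ?(le_trans ler01)//.
    by rewrite (lt_le_trans Mz)// ler_peMl.
  - apply: connected_continuous_connected.
      exact/connected_intervalP/interval_is_interval.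
    by apply: continuous_subspaceT => r; exact: cvgZr_tmp.
have z0 : 0 < `|z| by exact: lt_trans M0 Mz.
have := hN (`|N| + 1); rewrite (le_lt_trans (ler_norm N)) ?ltrDl// => /(_ isT).
set K := `|N| + 1 => hK.
pose r := 1 + (K + 1) / `|z|.
have K0 : 0 <= K by rewrite addr_ge0.
have r1 : 1 <= r by rewrite lerDl divr_ge0// addr_ge0.
have : `|g r| <= K.
  by apply: hK; apply: sub; exists r => //=; rewrite in_itv /= r1.
rewrite normrZ ger0_norm ?(le_trans ler01)// mulrDl mul1r divfK ?gt_eqF//.
by apply/negP; rewrite -ltNge; clearbody K; lra.
Qed.

End Region.

(** * One flight *)

Section Frame.
Context {R : realType}.
Implicit Types u v w z : plane R.

Lemma dotp_perp_unit w : dotp w w = 1 -> dotp (perp w) (perp w) = 1.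
Proof. by move=> <-; rewrite /dotp /perp !coE; ring. Qed.

Lemma frame_decomp w z : dotp w w = 1 ->
  z = dotp z w *: w + dotp z (perp w) *: perp w.
Proof.
rewrite /dotp => w1; apply: planeP; rewrite /perp !coE.
  by rewrite -[LHS]mulr1 -w1; ring.
by rewrite -[LHS]mulr1 -w1; ring.
Qed.

End Frame.

Section Flight.
Context {R : realType} {n : nat} (C : 'I_n -> plane R).
Hypothesis hC : simple_polygon C.
Hypothesis hpos : positively_oriented C.
Implicit Types (i j k : 'I_n) (r s t : R) (z y : plane R) (x : plane R).

Local Notation bd := (poly_boundary C).
Local Notation inside := (poly_interior C).

(** The velocity [bv], written in the frame of the tangent and the inner normal. *)
Definition vel i (a : R) : plane R := sin a *: tang C i + cos a *: perp (tang C i).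

Lemma velE i (a : R) : rotate (pi / 2 - a) (tang C i) = vel i a.
Proof.
apply: planeP; rewrite /vel /rotate /perp !coE cosB sinB cos_pihalf sin_pihalf; ring.
Qed.

(** Signed distance to the line carrying the side, positive on the inner side. *)
Definition height i z : R := dotp (z - C i) (perp (tang C i)).

Lemma height_side_at i s : height i (side_at C i s) = 0.
Proof. by rewrite /height /side_at /dotp /perp !coE; ring. Qed.

Lemma height0_side_at i z : height i z = 0 ->
  z = side_at C i (brk C i + dotp (z - C i) (tang C i)).
Proof.
rewrite /height => h; rewrite /side_at addrAC subrr add0r.
have := frame_decomp (z - C i) (dotp_tang hC i).
by rewrite h scale0r addr0 => <-; rewrite addrC subrK.
Qed.

Lemma height_side i z : side C i z -> height i z = 0.
Proof. by move=> /(sideP hC)[s _ ->]; exact: height_side_at. Qed.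

Lemma heightD i z (r : R) y : height i (z + r *: y) = height i z + r * dotp (perp (tang C i)) y.
Proof. by rewrite /height /dotp !coE; ring. Qed.

Lemma dotp_perp_vel i (a : R) : dotp (perp (tang C i)) (vel i a) = cos a.
Proof.
rewrite -[RHS]mulr1 -(dotp_tang hC i) /dotp /vel /perp !coE; ring.
Qed.

Lemma vel_unit i (a : R) : dotp (vel i a) (vel i a) = 1.
Proof.
transitivity ((cos a ^+ 2 + sin a ^+ 2) * dotp (tang C i) (tang C i)).
  by rewrite /dotp /vel /perp !coE; ring.
by rewrite cos2Dsin2 mul1r dotp_tang.
Qed.

Lemma cos_angle (a : R) : angles a -> 0 < cos a.
Proof. by rewrite /angles /= in_itv /= => h; exact: cos_gt0_pihalf. Qed.

Section FromSide.
Variables (i : 'I_n) (x : plane R).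
Hypothesis hs : brk C i < xco x < brk C i.+1.

Lemma bqE : bq C x = side_at C i (xco x).
Proof. by have [h1 h2] := andP hs; rewrite /bq (zetaE hC (i := i)) ?(ltW h1) ?(ltW h2). Qed.

Lemma bvE : bv C x = vel i (yco x).
Proof. by rewrite /bv (derive1_zeta hC hs) velE. Qed.

(** Near an interior point of a side the polygon is a half disc: the orientation
    puts one point of it in the interior, hence all of it. *)
Lemma flight_start : angles (yco x) ->
  exists2 t, 0 < t & forall r, 0 < r < t -> inside (bq C x + r *: bv C x).
Proof.
move=> /cos_angle c0.
have [e e0 he] : exists2 e, 0 < e & forall y, `|bq C x - y| < e ->
    forall k, k != i -> ~ side C k y.
  have : \forall y \near bq C x, forall k, k != i -> ~ side C k y.
    apply: (@filter_forall _ _ (fun k y => k != i -> ~ side C k y) (nbhs (bq C x)) _) => k.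
    have [->|ki] := eqVneq k i.
      by apply: nearW.
    have : nbhs (bq C x) (~` side C k).
      apply: open_nbhs_nbhs; split; first exact/closed_openC/side_closed.
      rewrite bqE => hk; have := side_open_unique hC hs hk.
      by move/eqP: ki.
    by apply: filterS.
  by case/nbhs_normP => e /= e0 h; exists e => // y hy; exact: h.
set q := bq C x; set v := bv C x.
have v0 : 0 < `|v| + 1 by rewrite ltr_wpDl.
exists (e / (`|v| + 1)) => [|r /andP[r0 re]]; first by rewrite divr_gt0.
have hv : `|r *: v| < e.
  rewrite normrZ gtr0_norm//; move: re; rewrite ltr_pdivlMr// mulrDr mulr1.
  by move=> h; apply: le_lt_trans h; rewrite lerDl ltW.
have nb : ~ is_brk C (xco x).
  move=> [k kn ek]; have /andP[h1 h2] := hs.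
  have [ki|ik] := leqP k i; first by have := brk_le hC ki; rewrite -ek; lra.
  by have := brk_le hC ik; rewrite -ek; lra.
have := hpos (brk_open_itv hC hs) nb.
rewrite (derive1_zeta hC hs) rotate_pihalf -/(bq C x) -/q => near0.
set nn := perp (tang C i) in near0.
have [d [d0 [dn di]]] : exists d : R, 0 < d /\ (`|d *: nn| < e /\ inside (q + d *: nn)).
  have : \forall d \near 0^'+, 0 < d /\ (`|d *: nn| < e /\ inside (q + d *: nn)).
    near=> d; split; first by near: d; exact: nbhs_right_gt.
    split; last by near: d; exact: near0.
    have dp : 0 < d by near: d; exact: nbhs_right_gt.
    rewrite normrZ gtr0_norm//.
    have n1 : 0 < `|nn| + 1 by rewrite ltr_wpDl.
    have : d < e / (`|nn| + 1).
      by near: d; apply: nbhs_right_lt; rewrite divr_gt0.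
    rewrite ltr_pdivlMr// mulrDr mulr1 => h.
    by apply: le_lt_trans h; rewrite lerDl ltW.
  by move=> h; have [d hd] := filter_ex h; exists d.
apply: (segment_interior di) => p /andP[p0 p1].
have -> : q + d *: nn + p *: (q + r *: v - (q + d *: nn)) =
          q + ((1 - p) *: (d *: nn) + p *: (r *: v)).
  by apply: planeP; rewrite !coE; ring.
set w := (1 - p) *: _ + _ => -[k _ hk].
have we : `|w| < e.
  rewrite (le_lt_trans (ler_normD _ _))//.
  rewrite [X in X + _]normrZ [X in _ + X]normrZ !ger0_norm ?subr_ge0//.
  by apply: convex_lt; rewrite ?p0.
have ki : k = i.
  apply/eqP/negPn/negP => ki; apply: (he (q + w) _ k ki) => //.
  by rewrite opprD addrA subrr add0r normrN.
have := height_side hk; rewrite ki.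
rewrite -(scale1r w) heightD {1}/q bqE height_side_at add0r mul1r.
have -> : dotp (perp (tang C i)) w = (1 - p) * (d * dotp nn nn) + p * (r * dotp nn v).
  by rewrite /w /nn /dotp !coE; ring.
rewrite (dotp_perp_unit (dotp_tang hC i)) mulr1 /v bvE dotp_perp_vel.
have rc : 0 < r * cos (yco x) by rewrite mulr_gt0.
have : (1 - p) * - d + p * - (r * cos (yco x)) < 0.
  by apply: convex_lt; rewrite ?oppr_lt0 ?p0.
by lra.
Unshelve. all: by end_near. Qed.

Lemma bt_unique t : 0 < t -> (forall r, 0 < r < t -> inside (bq C x + r *: bv C x)) ->
  ~ inside (bq C x + t *: bv C x) -> bt C x = t.
Proof.
move=> t0 ht nt; rewrite /bt (_ : [set _ | _] = [set` `]0, t]]).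
  by apply: sup_itv; rewrite bnd_simp.
apply/seteqP; split=> u /=; rewrite in_itv /=.
  move=> [u0 hu]; rewrite u0 /= leNgt; apply/negP => tu; apply: nt.
  by apply: hu; exists t => //=; rewrite in_itv /= t0.
move=> /andP[u0 ut]; split=> // y [r hr <-]; apply: ht.
by move: hr; rewrite /= in_itv /= => /andP[-> /lt_le_trans ->].
Qed.

End FromSide.

(** The velocity is a unit vector and the interior is bounded. *)
Lemma flight_bounded : exists2 M, 0 < M & forall i x t,
  brk C i < xco x < brk C i.+1 -> 0 < t ->
  (forall r, 0 < r < t -> inside (bq C x + r *: bv C x)) -> t <= M.
Proof.
have [M1 M10 h1] := boundary_bounded C; have [M2 M20 h2] := interior_bounded C.
exists (4 * (M1 + M2)); first by rewrite mulr_gt0// addr_gt0.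
move=> i x t hs t0 ht; have [hs1 hs2] := andP hs.
have bq1' : `|bq C x| <= M1.
  apply: h1; exists i => //; rewrite (bqE hs); apply: (mem_side hC).
  by rewrite (ltW hs1) (ltW hs2).
set v := bv C x.
have rv r : 0 < r < t -> `|r *: v| <= M1 + M2.
  move=> hr; have -> : r *: v = (bq C x + r *: v) - bq C x by rewrite addrAC subrr add0r.
  by rewrite (le_trans (ler_normB _ _))// addrC lerD// h2//; exact: ht.
have v1 : 1 <= `|xco v| + `|yco v|.
  have := vel_unit i (yco x); rewrite -(bvE hs) -/v /dotp -!expr2 => e.
  have e' : `|xco v| ^+ 2 + `|yco v| ^+ 2 = 1 by rewrite !real_normK ?num_real.
  have ab := mulr_ge0 (normr_ge0 (xco v)) (normr_ge0 (yco v)).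
  have sq : 1 <= (`|xco v| + `|yco v|) ^+ 2 by rewrite sqrrD; lra.
  by rewrite -(@ler_pXn2r _ 2) ?nnegrE ?addr_ge0// expr1n.
have th : 0 < t / 2 < t by rewrite divr_gt0//= ltr_pdivrMr// ltr_pMr// ltr1n.
have hx := le_trans (norm_xco _) (rv _ th); have hy := le_trans (norm_yco _) (rv _ th).
move: hx hy; rewrite xcoZ ycoZ !(normrM (t / 2)) (gtr0_norm (x := t / 2)) ?divr_gt0// => hx hy.
have h : t / 2 * 1 <= t / 2 * (`|xco v| + `|yco v|).
  by rewrite ler_wpM2l// divr_ge0// ltW.
by rewrite mulrDr in h; lra.
Qed.

End Flight.

(** * Landing *)

Section Landing.
Context {R : realType} {n : nat} (C : 'I_n -> plane R).
Hypothesis hC : simple_polygon C.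
Hypothesis hpos : positively_oriented C.
Implicit Types (i j k : 'I_n) (r s t : R) (z y : plane R) (x : plane R).

Local Notation bd := (poly_boundary C).
Local Notation inside := (poly_interior C).

(** The interior is open, and closed off the boundary: if a flight stopped elsewhere
    than on the boundary it could be prolonged. *)
Lemma flight_end i x : brk C i < xco x < brk C i.+1 -> angles (yco x) ->
  [/\ 0 < bt C x, forall r, 0 < r < bt C x -> inside (bq C x + r *: bv C x)
    & bd (bq1 C x)].
Proof.
move=> hs ha; have [t0 t00 ht0] := flight_start hC hpos hs ha.
have [M M0 hM] := flight_bounded hC.
set q := bq C x in ht0 *; set v := bv C x in ht0 *.
set A := [set tau | 0 < tau /\ [set q + r *: v | r in `]0, tau[] `<=` inside].
have AE tau : A tau <-> 0 < tau /\ forall r, 0 < r < tau -> inside (q + r *: v).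
  split=> -[h1 h2]; split=> //.
    by move=> r hr; apply: h2; exists r => //; rewrite /= in_itv.
  by move=> y [r hr <-]; apply: h2; move: hr; rewrite /= in_itv.
have supA : has_sup A.
  split; first by exists t0; exact/AE.
  by exists M => u /AE[u0 hu]; exact: (hM i x).
have Bt : bt C x = sup A by [].
have tt0 : t0 <= bt C x by rewrite Bt; apply: ub_le_sup; [case: supA | exact/AE].
have tp : 0 < bt C x by apply: lt_le_trans tt0.
have itv r : 0 < r < bt C x -> inside (q + r *: v).
  move=> /andP[r0 rt]; have e0 : 0 < bt C x - r by rewrite subr_gt0.
  have [u /AE[_ hu]] := sup_adherent e0 supA; rewrite -Bt => ru.
  by apply: hu; rewrite r0 /=; lra.
split=> //; apply: contrapT => nb; rewrite /bq1 -/q -/v in nb.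
have v1 : 0 < `|v| + 1 by rewrite ltr_wpDl.
have small (e : R) : 0 < e -> forall r, `|r| * (`|v| + 1) < e -> `|r *: v| < e.
  move=> e0 r; rewrite normrZ mulrDr mulr1; apply: le_lt_trans.
  by rewrite lerDl.
have iz : inside (q + bt C x *: v).
  apply: interior_adherent => // e e0.
  pose d := Num.min (bt C x / 2) (e / (`|v| + 1) / 2).
  have d0 : 0 < d by rewrite lt_min !divr_gt0.
  have d1 : d <= bt C x / 2 by rewrite ge_min lexx.
  have d2 : d <= e / (`|v| + 1) / 2 by rewrite ge_min lexx orbT.
  exists (q + (bt C x - d) *: v); last by apply: itv; rewrite subr_gt0; lra.
  have -> : q + bt C x *: v - (q + (bt C x - d) *: v) = d *: v.
    by apply: planeP; rewrite !(xcoD, xcoN, xcoZ, ycoD, ycoN, ycoZ); ring.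
  apply: small => //; rewrite gtr0_norm// -ltr_pdivlMr//.
  apply: (le_lt_trans d2); rewrite ltr_pdivrMr// ltr_pMr ?divr_gt0//; lra.
have /nbhs_normP[e /= e0 he] := interior_open iz.
pose d := e / (`|v| + 1) / 2.
have d0 : 0 < d by rewrite !divr_gt0.
suff /(ub_le_sup supA.2) : A (bt C x + d) by rewrite -Bt; lra.
apply/AE; split; first by rewrite addr_gt0.
move=> r /andP[r0 rd]; have [rt|tr] := ltP r (bt C x); first by apply: itv; rewrite r0.
apply: he; rewrite /ball_ /=.
have -> : q + bt C x *: v - (q + r *: v) = (bt C x - r) *: v.
  by apply: planeP; rewrite !(xcoD, xcoN, xcoZ, ycoD, ycoN, ycoZ); ring.
apply: small => //; rewrite distrC ger0_norm ?subr_ge0// -ltr_pdivlMr//.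
apply: (@lt_trans _ _ d); first by lra.
rewrite ltr_pdivrMr// ltr_pMr ?divr_gt0//; lra.
Qed.

(** The initials stand for normal and tangential, in the frame of the landing side. *)
Definition nspeed i j (a : R) : R := dotp (perp (tang C j)) (vel C i a).
Definition tspeed i j (a : R) : R := dotp (tang C j) (vel C i a).

(** Time, point and parameter of the hit of the line carrying the side [j]. They are
    explicit functions of the collision, even where the actual flight ends on some
    other side. *)
Definition hit_time i j x : R :=
  - height C j (side_at C i (xco x)) / nspeed i j (yco x).
Definition hit_pt i j x : plane R :=
  side_at C i (xco x) + hit_time i j x *: vel C i (yco x).
Definition hit_pos i j x : R := brk C j + dotp (hit_pt i j x - C j) (tang C j).

Lemma pos_side_at j s : brk C j + dotp (side_at C j s - C j) (tang C j) = s.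
Proof.
rewrite /side_at addrAC subrr add0r.
have -> : dotp ((s - brk C j) *: tang C j) (tang C j) =
    (s - brk C j) * dotp (tang C j) (tang C j) by rewrite /dotp !coE; ring.
by rewrite dotp_tang// mulr1 addrC subrK.
Qed.

Lemma height_hit i j x : nspeed i j (yco x) != 0 -> height C j (hit_pt i j x) = 0.
Proof.
by move=> h; rewrite /hit_pt heightD -/(nspeed i j (yco x)) /hit_time divfK// subrr.
Qed.

Lemma hit_ptE i j x : nspeed i j (yco x) != 0 ->
  hit_pt i j x = side_at C j (hit_pos i j x).
Proof. by move=> /height_hit/(height0_side_at hC). Qed.

Definition leaves_lands i j x : Prop :=
  [/\ brk C i < xco x < brk C i.+1, angles (yco x), 0 < hit_time i j x,
      brk C j < hit_pos i j x < brk C j.+1 & nspeed i j (yco x) != 0].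

(** A flight off the singular set does not end at a vertex; it cannot arrive
    tangentially to a side, for it would then have travelled inside that side. *)
Lemma flight_between x : billiard_dom C x ->
  exists i j, leaves_lands i j x /\ bt C x = hit_time i j x.
Proof.
move=> [[sx ax] nN].
have nv : ~ is_brk C (xco x) by move=> h; apply: nN; left; right.
have nC k : bq1 C x <> C k.
  move=> e; apply: nN; right; exists k => //; apply: subset_closure; split => //.
  by split => // -[].
have [i hs] := brk_locate_open hC sx nv.
have [t0 ht [j _ hj]] := flight_end hs ax.
have [s hsj es] := (sideP hC j _).1 hj.
have hsj' : brk C j < s < brk C j.+1.
  have [h1 h2] := andP hsj; rewrite !lt_neqAle h1 h2 !andbT.
  apply/andP; split; apply/eqP => e; apply: (nC _); rewrite es.
    by rewrite -e side_at_brk.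
  by rewrite e side_at_brkS.
have H0 : nspeed i j (yco x) != 0.
  (* a flight along the line of the side [j] would run inside that side just
     before landing *)
  apply/negP => /eqP H0.
  have hq r : height C j (bq1 C x + r *: bv C x) = 0.
    rewrite heightD (bvE hC hs) -/(nspeed i j (yco x)) H0 mulr0 addr0.
    exact: height_side.
  pose p r := brk C j + dotp (bq1 C x + r *: bv C x - C j) (tang C j).
  have p0 : p 0 = s.
    by rewrite /p scale0r addr0 es pos_side_at.
  have cp : p r @[r --> 0^'-] --> s.
    apply: cvg_at_left_filter; rewrite -p0.
    apply: cvgD; first exact: cvg_cst.
    apply: cvg_dotp; last exact: cvg_cst.
    apply: cvgB; last exact: cvg_cst.
    by apply: cvgD; [exact: cvg_cst | exact: cvgZr_tmp].
  have [h1 h2] := andP hsj'.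
  near (0:R)^'- => r.
  have r0 : r < 0 by near: r; exact: nbhs_left_lt.
  have rt : - bt C x < r by near: r; apply: nbhs_left_gt; rewrite oppr_lt0.
  have [_ nb] : inside (bq C x + (bt C x + r) *: bv C x) by apply: ht; lra.
  apply: nb; exists j => //; apply/(sideP hC); exists (p r).
    apply/andP; split; apply: ltW; near: r.
      exact: (cvgr_gt s cp).
    exact: (cvgr_lt s cp).
  have -> : bq C x + (bt C x + r) *: bv C x = bq1 C x + r *: bv C x.
    by rewrite /bq1 scalerDl addrA.
  by apply: height0_side_at.
have tE : bt C x = hit_time i j x.
  have := height_side hC hj; rewrite /bq1 heightD (bvE hC hs) (bqE hC hs).
  rewrite -/(nspeed i j (yco x)) => /eqP; rewrite addrC addr_eq0 => /eqP h.
  by rewrite /hit_time -h mulfK.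
exists i, j; split=> //; split=> //; first by rewrite -tE.
suff -> : hit_pos i j x = s by [].
have : hit_pt i j x = side_at C j s.
  by rewrite -es /bq1 (bvE hC hs) (bqE hC hs) tE.
by rewrite /hit_pos => ->; exact: pos_side_at.
Unshelve. all: by end_near. Qed.

End Landing.

(** * Persistence of the flight *)

Section Persistence.
Context {R : realType} {n : nat} (C : 'I_n -> plane R).
Hypothesis hC : simple_polygon C.
Hypothesis hpos : positively_oriented C.
Implicit Types (i j k : 'I_n) (r s t : R) (z y : plane R) (x : plane R).

Local Notation bd := (poly_boundary C).
Local Notation inside := (poly_interior C).

Section Limits.
Variables (T : Type) (F : set_system T) (p : T -> plane R) (x : plane R).
Context {FF : Filter F}.
Hypothesis px : p @ F --> x.

Lemma cvg_vel i : vel C i (yco (p t)) @[t --> F] --> vel C i (yco x).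
Proof.
have hy := cvg_yco px; rewrite /vel.
by apply: cvgD; apply: cvgZr_tmp; [apply: (cvg_comp _ sin hy) | apply: (cvg_comp _ cos hy)];
  [exact: continuous_sin | exact: continuous_cos].
Qed.

Lemma cvg_side_at i : side_at C i (xco (p t)) @[t --> F] --> side_at C i (xco x).
Proof.
rewrite /side_at; apply: cvgD; first exact: cvg_cst.
by apply: cvgZr_tmp; apply: cvgB; [exact: cvg_xco | exact: cvg_cst].
Qed.

Lemma cvg_nspeed i j : nspeed C i j (yco (p t)) @[t --> F] --> nspeed C i j (yco x).
Proof. by apply: cvg_dotp; [exact: cvg_cst | exact: cvg_vel]. Qed.

Lemma cvg_tspeed i j : tspeed C i j (yco (p t)) @[t --> F] --> tspeed C i j (yco x).
Proof. by apply: cvg_dotp; [exact: cvg_cst | exact: cvg_vel]. Qed.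

Variables i j : 'I_n.
Hypothesis H0 : nspeed C i j (yco x) != 0.

Lemma cvg_hit_time : hit_time C i j (p t) @[t --> F] --> hit_time C i j x.
Proof.
rewrite /hit_time; apply: cvgM; last by apply: cvgV => //; exact: cvg_nspeed.
apply: cvgN; rewrite /height; apply: cvg_dotp; last exact: cvg_cst.
by apply: cvgB; [exact: cvg_side_at | exact: cvg_cst].
Qed.

Lemma cvg_hit_pt : hit_pt C i j (p t) @[t --> F] --> hit_pt C i j x.
Proof.
rewrite /hit_pt; apply: cvgD; first exact: cvg_side_at.
by apply: cvgZ; [exact: cvg_hit_time | exact: cvg_vel].
Qed.

Lemma cvg_hit_pos : hit_pos C i j (p t) @[t --> F] --> hit_pos C i j x.
Proof.
rewrite /hit_pos; apply: cvgD; first exact: cvg_cst.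
apply: cvg_dotp; last exact: cvg_cst.
by apply: cvgB; [exact: cvg_hit_pt | exact: cvg_cst].
Qed.

End Limits.

(** The segment aimed at the line of the side [j]; it is the flight of [x] only if the
    latter ends there. *)
Definition hit_path i j x r : plane R :=
  side_at C i (xco x) + (r * hit_time C i j x) *: vel C i (yco x).

Lemma cvg_hit_path (T : Type) (F : set_system T) {FF : Filter F} (p : T -> plane R)
    (q : T -> R) i j x r : nspeed C i j (yco x) != 0 ->
  p @ F --> x -> q @ F --> r -> hit_path i j (p t) (q t) @[t --> F] --> hit_path i j x r.
Proof.
move=> H0 px qr; rewrite /hit_path; apply: cvgD; first exact: cvg_side_at.
by apply: cvgZ; [apply: cvgM => //; exact: cvg_hit_time | exact: cvg_vel].
Qed.

Lemma hit_path_avoids i j k x : leaves_lands C i j x -> bt C x = hit_time C i j x ->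
  k != i -> k != j -> forall r, 0 <= r <= 1 -> ~ side C k (hit_path i j x r).
Proof.
move=> [hs ha t0 hp H0] et ki kj r /andP[r0 r1] hk.
have [_ ht _] := flight_end hC hpos hs ha.
move: r0; rewrite le_eqVlt => /predU1P[r0|r0].
  move: hk; rewrite /hit_path -r0 mul0r scale0r addr0.
  by move=> /(side_open_unique hC hs)/eqP; rewrite (negPf ki).
move: r1; rewrite le_eqVlt => /predU1P[r1|r1].
  move: hk; rewrite /hit_path r1 mul1r -/(hit_pt C i j x) hit_ptE//.
  by move=> /(side_open_unique hC hp)/eqP; rewrite (negPf kj).
have [_] : inside (hit_path i j x r).
  rewrite /hit_path -et -(bqE hC hs) -(bvE hC hs); apply: ht.
  by rewrite mulr_gt0 -?et ?gtr_pMl ?et//= et.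
by apply; exists k.
Qed.

(** The closed flight segment is compact and misses every side other than its two
    ends, hence so do the neighbouring segments. *)
Lemma hit_path_avoids_near i j x : leaves_lands C i j x ->
  bt C x = hit_time C i j x ->
  \forall y \near x, forall k, k != i -> k != j ->
    forall r, 0 <= r <= 1 -> ~ side C k (hit_path i j y r).
Proof.
move=> hx et.
apply: (@filter_forall _ _ (fun k y => k != i -> k != j ->
    forall r, 0 <= r <= 1 -> ~ side C k (hit_path i j y r)) (nbhs x) _) => k.
have [->|ki] := eqVneq k i; first by apply: nearW.
have [->|kj] := eqVneq k j; first by apply: nearW.
have := (compact_near_coveringP _).1 (@segment_compact R 0 1).
move=> /(_ _ (nbhs x) (fun y r => ~ side C k (hit_path i j y r)) _).
have [_ _ _ _ H0] := hx.
have loc : forall r, [set` `[0, 1]] r -> \near r & x, ~ side C k (hit_path i j x r).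
  move=> r; rewrite /= in_itv /= => hr.
  have c : (fun p => hit_path i j p.2 p.1) @ (filter_prod (nbhs r) (nbhs x)) -->
      hit_path i j x r.
    by apply: cvg_hit_path => //; [exact: cvg_snd | exact: cvg_fst].
  have : nbhs (hit_path i j x r) (~` side C k).
    apply: open_nbhs_nbhs; split; first exact/closed_openC/side_closed.
    exact: (hit_path_avoids hx et ki kj hr).
  by move/c.
move=> /(_ loc); apply: filterS => y hy _ _ r hr; apply: (hy r).
by rewrite /= in_itv.
Qed.

(** Near [x] the segment aimed at the line of the side [j] meets the lines of the sides
    [i] and [j] only at its ends, and misses the other sides by compactness. Being
    connected, with its midpoint in the interior, it stays in the interior. *)
Lemma flight_near i j x : leaves_lands C i j x -> bt C x = hit_time C i j x ->
  \forall y \near x, leaves_lands C i j y /\ bt C y = hit_time C i j y.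
Proof.
move=> hx et; have [hs ha t0 hp H0] := hx.
have FF : Filter (nbhs x) := nbhs_filter x.
have [h1 h2] := andP hs; have [h3 h4] := andP hp.
have [h5 h6] : - (pi / 2) < yco x /\ yco x < pi / 2.
  by move: ha; rewrite /angles /= in_itv /= => /andP[].
have [_ ht _] := flight_end hC hpos hs ha.
have mid : inside (hit_path i j x 2^-1).
  rewrite /hit_path -et -(bqE hC hs) -(bvE hC hs); apply: ht.
  by rewrite et mulr_gt0//= gtr_pMl// invf_lt1// ltr1n.
have cm : hit_path i j y 2^-1 @[y --> x] --> hit_path i j x 2^-1.
  exact: (cvg_hit_path H0 cvg_id (cvg_cst _)).
near=> y.
have hsy : brk C i < xco y < brk C i.+1.
  apply/andP; split; near: y.
    by apply: (cvgr_gt (xco x)) => //; exact: continuous_xco.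
  by apply: (cvgr_lt (xco x)) => //; exact: continuous_xco.
have hay : angles (yco y).
  rewrite /angles /= in_itv /=; apply/andP; split; near: y.
    by apply: (cvgr_gt (yco x)) => //; exact: continuous_yco.
  by apply: (cvgr_lt (yco x)) => //; exact: continuous_yco.
have t0y : 0 < hit_time C i j y.
  by near: y; apply: (cvgr_gt (hit_time C i j x)) => //; exact: (cvg_hit_time cvg_id).
have hpy : brk C j < hit_pos C i j y < brk C j.+1.
  apply/andP; split; near: y.
    by apply: (cvgr_gt (hit_pos C i j x)) => //; exact: (cvg_hit_pos cvg_id).
  by apply: (cvgr_lt (hit_pos C i j x)) => //; exact: (cvg_hit_pos cvg_id).
have H0y : nspeed C i j (yco y) != 0.
  by near: y; apply: (cvgr_neq0 (nspeed C i j (yco x))) => //; exact: (cvg_nspeed cvg_id).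
have midy : inside (hit_path i j y 2^-1).
  by near: y; apply: cm; exact: interior_open.
have av : forall k, k != i -> k != j ->
    forall r, 0 <= r <= 1 -> ~ side C k (hit_path i j y r).
  by near: y; exact: hit_path_avoids_near.
split=> //; apply: bt_unique => //; rewrite (bqE hC hsy) (bvE hC hsy); last first.
  move=> [_]; apply; exists j => //; rewrite -/(hit_pt C i j y) hit_ptE//.
  by apply: (mem_side hC); have [? ?] := andP hpy; rewrite !ltW.
pose g r := hit_path i j y r.
suff sub : g @` `]0, 1[ `<=` inside.
  move=> r /andP[r0 rt].
  have -> : side_at C i (xco y) + r *: vel C i (yco y) = g (r / hit_time C i j y).
    by rewrite /g /hit_path divfK// gt_eqF.
  apply: sub; exists (r / hit_time C i j y) => //.
  by rewrite /= in_itv /= divr_gt0//= ltr_pdivrMr// mul1r.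
apply: (@connected_interior _ _ _ _ (g 2^-1)) => //.
- apply: connected_continuous_connected.
    exact/connected_intervalP/interval_is_interval.
  apply: continuous_subspaceT => r.
  rewrite /g /hit_path; apply: cvgD; first exact: cvg_cst.
  by apply: cvgZr_tmp; apply: cvgMr_tmp.
- move=> z [r hr <-] [k _ hk].
  have /andP[r0 r1] : 0 < r < 1 by move: hr; rewrite /= in_itv.
  have ki : k != i.
    apply/eqP => ki; move: hk; rewrite ki => /(height_side hC).
    rewrite /g /hit_path heightD height_side_at add0r dotp_perp_vel//.
    have c0 := cos_angle hay.
    by apply/eqP; rewrite gt_eqF// (mulr_gt0 (mulr_gt0 r0 t0y) c0).
  have kj : k != j.
    apply/eqP => kj; move: hk; rewrite kj => /(height_side hC).
    have := height_hit H0y.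
    rewrite /g /hit_path /hit_pt !heightD -/(nspeed C i j (yco y)) => e1 e2.
    have : (1 - r) * (hit_time C i j y * nspeed C i j (yco y)) = 0 by lra.
    apply/eqP; apply: mulf_neq0; first by rewrite subr_eq0 gt_eqF.
    exact: mulf_neq0 (lt0r_neq0 t0y) H0y.
  by apply: (av k ki kj r) => //; rewrite !ltW.
- by exists 2^-1 => //; rewrite /= in_itv /= invr_gt0 ltr0n invf_lt1 ?ltr1n.
Unshelve. all: by end_near. Qed.

Lemma bs1E i j x : leaves_lands C i j x -> bt C x = hit_time C i j x ->
  bs1 C x = hit_pos C i j x.
Proof.
move=> [hs ha t0 hp H0] et; have [h3 h4] := andP hp.
have e1 : bq1 C x = side_at C j (hit_pos C i j x).
  by rewrite /bq1 (bqE hC hs) (bvE hC hs) et -/(hit_pt C i j x) hit_ptE.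
have hz : zeta C (hit_pos C i j x) = bq1 C x.
  by rewrite e1 (zetaE hC (i := j))// !ltW.
have /andP[p0 p1] := brk_open_itv hC hp.
have : [set s | 0 <= s <= perimeter C /\ zeta C s = bq1 C x] (bs1 C x).
  by apply: (@getPex _ [set s | 0 <= s <= perimeter C /\ zeta C s = bq1 C x]);
    exists (hit_pos C i j x); rewrite /= !ltW.
by move=> [hr]; rewrite -hz; apply: (zeta_inj_open hC hp).
Qed.

Lemma tangent1E i j x : leaves_lands C i j x -> bt C x = hit_time C i j x ->
  tangent1 C x = tang C j.
Proof.
by move=> hx et; rewrite /tangent1 (bs1E hx et); case: hx => _ _ _ hp _; exact: derive1_zeta.
Qed.

(** A reflection preserves the tangential component of the velocity. *)
Lemma btheta1E i j x : leaves_lands C i j x -> bt C x = hit_time C i j x ->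
  btheta1 C x = asin (tspeed C i j (yco x)).
Proof.
move=> hx et; rewrite /btheta1 /bv1 (tangent1E hx et) (_ : bv C x = vel C i (yco x)).
  congr asin; rewrite /tspeed; set w := tang C j; set v := vel _ _ _.
  transitivity (- dotp w v + 2 * dotp w v * dotp w w).
    by rewrite /dotp !(xcoD, xcoN, xcoZ, ycoD, ycoN, ycoZ); ring.
  by rewrite /w dotp_tang//; ring.
by case: hx => hs _ _ _ _; exact: bvE.
Qed.

Lemma speedsE i j (a : R) : tspeed C i j a ^+ 2 + nspeed C i j a ^+ 2 = 1.
Proof.
rewrite -(vel_unit hC i a) -[RHS]mul1r -(dotp_tang hC j).
by rewrite /tspeed /nspeed /dotp /perp !(xco_pt, yco_pt); ring.
Qed.

End Persistence.

(** * The differential of the billiard map *)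

(** The difference of the two functions vanishes near [x], hence has differential 0. *)
Lemma near_eq_is_diff (R : numFieldType) (V W : normedModType R)
    (f g df : V -> W) (x : V) :
  (\forall y \near x, f y = g y) -> is_diff x f df -> is_diff x g df.
Proof.
move=> fg Hf.
have fgx : f x = g x by exact: nbhs_singleton fg.
have H0 : is_diff x (g - f) 0.
  pose z0 : {linear V -> W} := \0%R.
  have c0 : continuous z0 by exact: cst_continuous.
  have o0 : (g - f) \o shift x = cst ((g - f) x) + z0 +o_ 0 id.
    apply/eqaddoP => e e0; near=> h.
    have hx : f (h + x) = g (h + x).
      near: h; have sx : (fun h : V => h + x) @ 0 --> x.
        by rewrite -{2}(add0r x); apply: cvgD; [exact: cvg_id | exact: cvg_cst].
      exact: (sx _ fg).
    by rewrite !fctE /= hx fgx !subrr addr0 subrr normr0 mulr_ge0// ltW.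
  have d0 := diff_unique c0 o0.
  apply: DiffDef; last by rewrite d0.
  by apply/diff_locallyP; rewrite d0.
have := is_diffD Hf H0; rewrite addr0.
by rewrite (_ : f + (g - f) = g)//; apply/funext => y; rewrite !fctE addrC subrK.
Unshelve. all: by end_near. Qed.

Section Differentials.
Context {R : realType}.

Lemma is_diff_pt (f g df dg : plane R -> R) (x : plane R) :
  is_diff x f df -> is_diff x g dg ->
  is_diff x (fun y => pt (f y) (g y)) (fun v => pt (df v) (dg v)).
Proof.
move=> [f1 f2] [g1 g2].
have Z (h dh : plane R -> R) (w : plane R) : differentiable h x -> 'd h x = dh :> (_ -> _) ->
    is_diff x (fun y => h y *: w) (fun v => dh v *: w).
  move=> h1 h2; apply: DiffDef; first exact: differentiableZl.
  by rewrite diffZl// h2.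
have := is_diffD (Z f df (pt 1 0) f1 f2) (Z g dg (pt 0 1) g1 g2).
rewrite (_ : (fun y => pt (f y) (g y)) = (fun y => f y *: pt 1 0) + (fun y => g y *: pt 0 1)).
  move=> H; apply: is_diff_eq H _.
  by apply/funext => v; rewrite [RHS]pt_decomp.
by apply/funext => v; rewrite [LHS]pt_decomp.
Qed.

Lemma is_diff_comp1 (h : R -> R) (g dg : plane R -> R) (c : R) (x : plane R) :
  is_diff x g dg -> is_derive (g x) 1 h c ->
  is_diff x (fun y => h (g y)) (fun v => c * dg v).
Proof.
move=> Hg [h1 h2].
have Hh : is_diff (g x) h ( *:%R^~ c).
  have /derivable1_diffP d := h1.
  apply: DiffDef => //; rewrite diff1E// derive1E h2.
  by [].
apply: (is_diff_eq (is_diff_comp Hg Hh)).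
by apply/funext => v /=; rewrite [LHS]mulrC.
Qed.

Lemma is_diff_xco (x : plane R) : is_diff x (@xco R) (@xco R).
Proof.
have lin : linear (@xco R) by move=> a u v; rewrite !(xcoD, xcoZ).
pose M := GRing.isLinear.Build _ _ _ _ _ lin.
pose L : {linear plane R -> R} := HB.pack (@xco R) M.
apply: DiffDef; first exact: (@linear_differentiable _ _ _ L x (@continuous_xco R)).
exact: (@diff_lin _ _ _ L x (@continuous_xco R)).
Qed.

Lemma is_diff_yco (x : plane R) : is_diff x (@yco R) (@yco R).
Proof.
have lin : linear (@yco R) by move=> a u v; rewrite !(ycoD, ycoZ).
pose M := GRing.isLinear.Build _ _ _ _ _ lin.
pose L : {linear plane R -> R} := HB.pack (@yco R) M.
apply: DiffDef; first exact: (@linear_differentiable _ _ _ L x (@continuous_yco R)).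
exact: (@diff_lin _ _ _ L x (@continuous_yco R)).
Qed.

End Differentials.

Section BilliardDifferential.
Context {R : realType} {n : nat} (C : 'I_n -> plane R).
Hypothesis hC : simple_polygon C.
Hypothesis hpos : positively_oriented C.
Implicit Types (i j k : 'I_n) (r s t : R) (x y z : plane R).

Lemma speed_trig i j (a : R) :
  tspeed C i j a = dotp (tang C j) (tang C i) * sin a + dotp (tang C j) (perp (tang C i)) * cos a /\
  nspeed C i j a = dotp (tang C j) (tang C i) * cos a - dotp (tang C j) (perp (tang C i)) * sin a.
Proof.
by split; rewrite /tspeed /nspeed /vel /dotp /perp !(xcoD, ycoD, xcoZ, ycoZ, xco_pt, yco_pt); ring.
Qed.

Lemma is_derive_tspeed i j (a : R) : is_derive a 1 (tspeed C i j) (nspeed C i j a).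
Proof.
rewrite (_ : tspeed C i j = dotp (tang C j) (tang C i) *: sin +
    dotp (tang C j) (perp (tang C i)) *: cos); last first.
  by apply/funext => b; rewrite (speed_trig i j b).1.
apply: (is_derive_eq (is_deriveD (is_deriveZ _ (is_derive_sin a))
  (is_deriveZ _ (is_derive_cos a)))).
by rewrite (speed_trig i j a).2 scalerN.
Qed.

Lemma is_derive_nspeed i j (a : R) : is_derive a 1 (nspeed C i j) (- tspeed C i j a).
Proof.
rewrite (_ : nspeed C i j = dotp (tang C j) (tang C i) *: cos -
    dotp (tang C j) (perp (tang C i)) *: sin); last first.
  by apply/funext => b; rewrite (speed_trig i j b).2.
apply: (is_derive_eq (is_deriveB (is_deriveZ _ (is_derive_cos a))
  (is_deriveZ _ (is_derive_sin a)))).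
by rewrite (speed_trig i j a).1 scalerN opprD.
Qed.

(** Both sides are the cross product of [tang C i] with the velocity, computed in the
    frame of the side [j] and in that of the side [i]. *)
Lemma speed_cross i j (a : R) :
  dotp (tang C i) (tang C j) * nspeed C i j a -
  dotp (tang C i) (perp (tang C j)) * tspeed C i j a = cos a.
Proof.
transitivity (cos a * (dotp (tang C i) (tang C i) * dotp (tang C j) (tang C j))).
  rewrite (speed_trig i j a).1 (speed_trig i j a).2 /dotp /perp !(xco_pt, yco_pt); ring.
by rewrite !dotp_tang// !mulr1.
Qed.

(** A displacement along the departure side, or a turn of the velocity about the
    departure point, moves the trajectory sideways by [cos] times the displacement, or
    by the time of flight times the turn; dividing by the normal speed projects this on
    the line of the side [j] along the trajectory. *)
Lemma is_diff_hit_pos i j x : nspeed C i j (yco x) != 0 ->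
  is_diff x (hit_pos C i j) (fun v =>
    (cos (yco x) * xco v + hit_time C i j x * yco v) / nspeed C i j (yco x)).
Proof.
move=> H0.
pose A y := height C j (side_at C i (xco y)).
pose B y := brk C j + dotp (side_at C i (xco y) - C j) (tang C j).
pose K (a : R) := tspeed C i j a / nspeed C i j a.
have e : hit_pos C i j = B + - (A * (fun y => K (yco y))).
  apply/funext => y; rewrite /hit_pos /hit_pt /hit_time !fctE /A /B /K /tspeed.
  rewrite /dotp !(xcoD, ycoD, xcoN, ycoN, xcoZ, ycoZ); ring.
rewrite e.
have affine (g : R -> R) (c : R) : (forall s, g s = g 0 + s * c) ->
    is_diff x (fun y => g (xco y)) (fun v => c * xco v).
  move=> hg; apply: is_diff_comp1; first exact: is_diff_xco.
  rewrite (_ : g = cst (g 0) + c *: id); last first.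
    by apply/funext => s; rewrite hg !fctE /cst; congr (_ + _); exact: mulrC.
  apply: (is_derive_eq (is_deriveD (is_derive_cst _ _ _)
    (is_deriveZ c (is_derive_id (xco x) 1)))).
  by rewrite add0r [LHS]mulr1.
have hA : is_diff x A (fun v => dotp (tang C i) (perp (tang C j)) * xco v).
  apply: (affine (fun s => height C j (side_at C i s))) => s.
  by rewrite /height /side_at /dotp !(xcoD, ycoD, xcoN, ycoN, xcoZ, ycoZ); ring.
have hB : is_diff x B (fun v => dotp (tang C i) (tang C j) * xco v).
  apply: (affine (fun s => brk C j + dotp (side_at C i s - C j) (tang C j))) => s.
  by rewrite /side_at /dotp !(xcoD, ycoD, xcoN, ycoN, xcoZ, ycoZ); ring.
have hK : is_diff x (fun y => K (yco y)) (fun v => (nspeed C i j (yco x) ^- 2) * yco v).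
  apply: is_diff_comp1; first exact: is_diff_yco.
  apply: (is_derive_eq (is_deriveM (is_derive_tspeed i j (yco x))
    (is_deriveV H0 (is_derive_nspeed i j (yco x))))).
  rewrite -[LHS]/(_ * _ + _ * _) -[- _ *: _]/(_ * _).
  rewrite -[in RHS](mul1r (_ ^- 2)) -(speedsE hC i j (yco x)).
  by field.
apply: (is_diff_eq (is_diffB hB (is_diffM hA hK))); apply/funext => v.
rewrite -[LHS]/(_ * _ - (_ * (_ * _) + _ * (_ * _))).
rewrite /hit_time -(speed_cross i j (yco x)) -/(A x) /K.
by field.
Qed.

Lemma tspeed_bound i j (a : R) : nspeed C i j a != 0 -> -1 < tspeed C i j a < 1.
Proof.
move=> H0; rewrite -ltr_norml -(@ltr_pXn2r _ 2) ?nnegrE// expr1n.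
rewrite real_normK ?num_real// -(speedsE hC i j a) ltrDl.
by rewrite lt_neqAle eq_sym sqrf_eq0 H0 sqr_ge0.
Qed.

Lemma cos_asin_tspeed i j (a : R) : nspeed C i j a != 0 ->
  cos (asin (tspeed C i j a)) = `|nspeed C i j a|.
Proof.
move=> /tspeed_bound/andP[h1 h2]; rewrite cos_asin ?ltW//.
by rewrite -(speedsE hC i j a) addrAC subrr add0r sqrtr_sqr.
Qed.

Lemma asin_tspeed_angle i j (a : R) : nspeed C i j a != 0 ->
  angles (asin (tspeed C i j a)).
Proof.
move=> /tspeed_bound/andP[h1 h2]; rewrite /angles /= in_itv /=.
by rewrite asin_gtNpi2 ?asin_ltpi2 ?h1 ?h2 ?ltW.
Qed.

Variable f : R -> R.
Hypothesis df : forall a, angles a -> derivable f a 1.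

Lemma billiardE i j x : leaves_lands C i j x -> bt C x = hit_time C i j x ->
  billiard C f x = pt (hit_pos C i j x) (f (asin (tspeed C i j (yco x)))).
Proof. by move=> hx et; rewrite /billiard (bs1E hC hx et) (btheta1E hC hx et). Qed.

(** The arrival angle is the inverse sine of the tangential speed, whose derivative is
    the normal speed; as both speeds have squares of sum 1, the arrival angle turns at
    speed 1, up to sign. *)
Lemma is_diff_billiard i j x : leaves_lands C i j x -> bt C x = hit_time C i j x ->
  is_diff x (billiard C f) (fun v =>
    pt ((cos (yco x) * xco v + hit_time C i j x * yco v) / nspeed C i j (yco x))
       (derive1 f (asin (tspeed C i j (yco x))) *
          Num.sg (nspeed C i j (yco x)) * yco v)).
Proof.
move=> hx et; have [_ _ _ _ H0] := hx.
apply: (@near_eq_is_diff _ _ _ (fun y => pt (hit_pos C i j y) (f (asin (tspeed C i j (yco y)))))).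
  by apply: filterS (flight_near hC hpos hx et) => y [hy ety]; rewrite (billiardE hy ety).
apply: is_diff_pt; first exact: is_diff_hit_pos.
have h1 := is_diff_comp1 (is_diff_yco x) (is_derive_tspeed i j (yco x)).
have h2 := is_diff_comp1 h1 (is_derive1_asin (tspeed_bound H0)).
have h3 : is_derive (asin (tspeed C i j (yco x))) 1 f (derive1 f (asin (tspeed C i j (yco x)))).
  by rewrite derive1E; apply/derivableP/df/asin_tspeed_angle.
apply: (is_diff_eq (is_diff_comp1 h2 h3)); apply/funext => v.
have hb := tspeed_bound H0.
rewrite -cos_asin ?cos_asin_tspeed//; last by have [? ?] := andP hb; rewrite !ltW.
rewrite -!mulrA; congr (_ * _); rewrite !mulrA; congr (_ * _).
by rewrite [X in _ * X]numEsg mulrCA mulVf ?mulr1// normr_eq0.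
Qed.

End BilliardDifferential.

(** * Hyperbolicity of triangular cocycles *)

Section Triangular.
Context {R : realType}.
Variables (Phi : plane R -> plane R) (S : set (plane R)) (a b c : plane R -> R).
Hypothesis S_forward : forall x, S x -> S (Phi x).
Hypothesis S_diff : forall x, S x ->
  is_diff x Phi (fun v => pt (a x * xco v + b x * yco v) (c x * yco v)).
Hypothesis a_cont : forall x, S x -> {for x, continuous a}.
Hypothesis b_cont : forall x, S x -> {for x, continuous b}.
Hypothesis c_cont : forall x, S x -> {for x, continuous c}.
Hypothesis a_neq0 : forall x, S x -> a x != 0.
Hypothesis c_neq0 : forall x, S x -> c x != 0.
Variables (L B k0 rho : R).
Hypothesis L_gt0 : 0 < L.
Hypothesis L_lt1 : L < 1.
Hypothesis c_le : forall x, S x -> `|c x| <= L.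
Hypothesis ba_le : forall x, S x -> `|b x / a x| <= B.
Hypothesis k0_gt0 : 0 < k0.
Hypothesis rho_gt1 : 1 < rho.
Hypothesis a_growth : forall x m, S x ->
  k0 * rho ^+ m <= \prod_(k < m) `|a (iter k Phi x)|.
Implicit Types (x y v w : plane R) (m k N : nat).

Let S_iter x m : S x -> S (iter m Phi x).
Proof. by move=> Sx; elim: m => //= m; exact: S_forward. Qed.

Let rho_gt0 : 0 < rho. Proof. exact: lt_trans rho_gt1. Qed.

(* The invariance of a line field of slope [s] reads
   [s x = (c x / a x) * s (Phi x) - b x / a x]; iterating this along the forward orbit
   gives the opposite of the series of general term [u x]. *)
Let wgt m x : R := \prod_(k < m) (c (iter k Phi x) / a (iter k Phi x)).
Let u x m : R := wgt m x * (b (iter m Phi x) / a (iter m Phi x)).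

(* Bounded below by [k0 * rho ^+ m], the product of the [a] costs nothing but a
   constant; the decay comes from the [c]. *)
Let wgt_le x m : S x -> `|wgt m x| <= L ^+ m / k0.
Proof.
move=> Sx; rewrite /wgt normr_prod.
under eq_bigr do rewrite normrM normfV.
rewrite big_split /= prodfV ler_pM ?invr_ge0 ?prodr_ge0//.
  rewrite -[leRHS](_ : \prod_(k < m) L = _); last by rewrite prodr_const card_ord.
  by apply: ler_prod => k _; rewrite normr_ge0 c_le//; exact: S_iter.
have h := a_growth m Sx.
have h0 : k0 <= k0 * rho ^+ m by rewrite ler_peMr ?(ltW k0_gt0)// exprn_ege1// ltW.
rewrite lef_pV2 ?posrE ?(le_trans h0 h)//.
by rewrite (lt_le_trans k0_gt0)// (le_trans h0 h).
Qed.

Let B_ge0 x : S x -> 0 <= B.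
Proof. by move=> Sx; rewrite (le_trans (normr_ge0 _) (ba_le Sx)). Qed.

Let u_le x m : S x -> `|u x m| <= B / k0 * L ^+ m.
Proof.
move=> Sx; rewrite /u normrM (_ : B / k0 * _ = L ^+ m / k0 * B); last by ring.
by rewrite ler_pM// ?wgt_le// ba_le//; exact: S_iter.
Qed.

Let K : R := B / k0 / (1 - L).

Let series_u_le x m : S x -> `|series (u x) m| <= K.
Proof.
move=> Sx; rewrite /series /= (le_trans (ler_norm_sum _ _ _))//.
apply: (le_trans (ler_sum _ (fun k _ => u_le k Sx))).
apply: (geometric_le_lim m _ L_gt0); last by rewrite gtr0_norm.
by rewrite divr_ge0 ?(B_ge0 Sx) ?(ltW k0_gt0).
Qed.

Let series_u_cvg x : S x -> cvgn (series (u x)).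
Proof.
move=> Sx; apply: normed_cvg.
apply: (@series_le_cvg _ _ (geometric (B / k0) L)).
- by move=> m /=.
- by move=> m; rewrite /geometric /= mulr_ge0 ?exprn_ge0 ?divr_ge0 ?(B_ge0 Sx) ?ltW.
- by move=> m; exact: u_le.
- by apply: is_cvg_geometric_series; rewrite gtr0_norm.
Qed.

(* The stable line at [x] is spanned by [pt (slope x) 1]. *)
Let slope x : R := - limn (series (u x)).

Let wgtS m x : wgt m.+1 x = c x / a x * wgt m (Phi x).
Proof.
rewrite /wgt big_ord_recl /=; congr (_ * _).
by apply: eq_bigr => k _; rewrite -!iterSr.
Qed.

Let slope_le x : S x -> `|slope x| <= K.
Proof.
move=> Sx; rewrite /slope normrN -lim_norm; last exact: series_u_cvg.
apply: limr_le; first by apply: is_cvg_norm; exact: series_u_cvg.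
by apply: nearW => m; exact: series_u_le.
Qed.

Let slopeE x : S x -> a x * slope x + b x = c x * slope (Phi x).
Proof.
move=> Sx; have SPx := S_forward Sx.
have h : limn (series (u x)) = b x / a x + c x / a x * limn (series (u (Phi x))).
  apply: cvg_lim => //; rewrite -(cvg_shiftS (series (u x))) /=.
  have -> : (fun m => series (u x) m.+1) =
      (fun m => b x / a x + c x / a x * series (u (Phi x)) m).
    apply/funext => m; rewrite /series /= big_nat_recl//= {1}/u {1}/wgt big_ord0 mul1r.
    congr (_ + _); rewrite mulr_sumr; apply: eq_bigr => k _.
    by rewrite /u wgtS -mulrA -iterSr.
  apply: cvgD; first exact: cvg_cst.
  by apply: cvgM; [exact: cvg_cst | exact: series_u_cvg].
rewrite /slope h; field; exact: a_neq0.
Qed.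

Let slope_tail x N : S x -> slope x = - series (u x) N + wgt N x * slope (iter N Phi x).
Proof.
move=> Sx; elim: N => [|N IH].
  by rewrite /series /= big_geq// oppr0 add0r /wgt big_ord0 mul1r.
have SN := S_iter N Sx; rewrite IH seriesSr opprD -addrA; congr (_ + _).
rewrite {2}/wgt big_ord_recr /= -/(wgt N x) /u.
have /(canRL (addrK _)) e := slopeE SN.
have -> : slope (iter N Phi x) =
    (c (iter N Phi x) * slope (Phi (iter N Phi x)) - b (iter N Phi x)) / a (iter N Phi x).
  by rewrite -e mulrC mulKf// a_neq0.
by field; exact: a_neq0.
Qed.

Let iter_cont x m : S x -> {for x, continuous (iter m Phi)}.
Proof.
move=> Sx; elim: m => [|m IH]; first exact: cvg_id.
apply: (@continuous_comp _ _ _ (iter m Phi) Phi) => //.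
by apply: differentiable_continuous; have [] := S_diff (S_iter m Sx).
Qed.

Let series_u_cont x N : S x -> {for x, continuous (fun y => series (u y) N)}.
Proof.
move=> Sx.
have ci (g : plane R -> R) k : (forall y, S y -> {for y, continuous g}) ->
    {for x, continuous (fun y => g (iter k Phi y))}.
  move=> hg; apply: (@continuous_comp _ _ _ (iter k Phi) g); first exact: iter_cont.
  exact/hg/S_iter.
have cr (g : plane R -> R) k : (forall y, S y -> {for y, continuous g}) ->
    {for x, continuous (fun y => g (iter k Phi y) / a (iter k Phi y))}.
  move=> hg; apply: continuousM; first exact: ci.
  by apply: continuousV; [exact/a_neq0/S_iter | exact: ci].
have cw k : {for x, continuous (wgt k)}.
  elim: k => [|k IH].
    rewrite (_ : wgt 0 = cst 1); first exact: cst_continuous.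
    by apply/funext => y; rewrite /wgt big_ord0.
  rewrite (_ : wgt k.+1 = (fun y => wgt k y * (c (iter k Phi y) / a (iter k Phi y)))).
    by apply: continuousM; [exact: IH | exact: cr].
  by apply/funext => y; rewrite /wgt big_ord_recr.
elim: N => [|N IH].
  rewrite (_ : (fun y => series (u y) 0) = cst 0); first exact: cst_continuous.
  by apply/funext => y; rewrite /series /= big_geq.
rewrite (_ : (fun y => _) = (fun y => series (u y) N + u y N)).
  by apply: continuousD; [exact: IH | apply: continuousM; [exact: cw | exact: cr]].
by apply/funext => y; rewrite seriesSr.
Qed.

(* The slope is a uniform limit, on [S], of continuous functions. *)
Let slope_cont x (e : R) : S x -> 0 < e -> \forall y \near x, S y -> `|slope x - slope y| < e.
Proof.
move=> Sx e0.
have [N hN] : exists N, L ^+ N * (K / k0) < e / 3.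
  have L1 : `|L| < 1 by rewrite gtr0_norm.
  have e3 : 0 < e / 3 by rewrite divr_gt0.
  have [N _ hN] := (cvgrPdist_lt _ _).1 (cvg_geometric (K / k0) L1) _ e3.
  exists N; have := hN N (leqnn N).
  rewrite sub0r normrN /geometric /= mulrC; exact: le_lt_trans (ler_norm _).
have tail y : S y -> `|slope y + series (u y) N| < e / 3.
  move=> Sy; rewrite (slope_tail N Sy) addrAC addNr add0r normrM.
  apply: (le_lt_trans (ler_pM _ _ (wgt_le N Sy) (slope_le (S_iter N Sy)))) => //.
  by rewrite mulrAC -mulrA.
have /cvgrPdist_lt/(_ (e / 3)) := @series_u_cont x N Sx.
rewrite divr_gt0// => /(_ isT); apply: filterS => y hy Sy.
have := ltrD (ltrD (tail _ Sx) hy) (tail _ Sy); rewrite -!mulrDl.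
have -> : (e + e + e) / 3 = e by field.
apply: le_lt_trans.
have -> : slope x - slope y = (slope x + series (u x) N) -
    (series (u x) N - series (u y) N) - (slope y + series (u y) N) by ring.
by rewrite (le_trans (ler_normB _ _))// lerD2r ler_normB.
Unshelve. all: by end_near. Qed.

Let horiz : plane R := pt 1 0.
Let stab x : plane R := pt (slope x) 1.

Let prod_a m x : R := \prod_(k < m) a (iter k Phi x).
Let prod_c m x : R := \prod_(k < m) c (iter k Phi x).

Let prod_aS m x : prod_a m.+1 x = prod_a m x * a (iter m Phi x).
Proof. by rewrite /prod_a big_ord_recr. Qed.
Let prod_cS m x : prod_c m.+1 x = prod_c m x * c (iter m Phi x).
Proof. by rewrite /prod_c big_ord_recr. Qed.

Let diff_iter x m : S x -> [/\ differentiable (iter m Phi) x,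
    'd (iter m Phi) x horiz = prod_a m x *: horiz
  & 'd (iter m Phi) x (stab x) = prod_c m x *: stab (iter m Phi x)].
Proof.
move=> Sx; elim: m => [|m [IH1 IH2 IH3]].
  have [d0 e0] := is_diff_id x.
  by rewrite /prod_a /prod_c !big_ord0 !scale1r; split => //; rewrite [LHS](congr1 (@^~ _) e0).
have [d e] := S_diff (S_iter m Sx).
have ev v : 'd Phi (iter m Phi x) v = pt (a (iter m Phi x) * xco v + b (iter m Phi x) * yco v)
    (c (iter m Phi x) * yco v) := congr1 (fun g : plane R -> plane R => g v) e.
have comp v : 'd (iter m.+1 Phi) x v = 'd Phi (iter m Phi x) ('d (iter m Phi) x v).
  exact: (congr1 (fun g : plane R -> plane R => g v) (diff_comp IH1 d)).
split; first exact: (differentiable_comp IH1 d).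
  rewrite [LHS]comp [X in 'd Phi _ X]IH2 ev.
  rewrite prod_aS /horiz.
  by apply: planeP; rewrite !(xcoZ, ycoZ, xco_pt, yco_pt); ring.
rewrite [LHS]comp [X in 'd Phi _ X]IH3 ev.
rewrite prod_cS iterS /stab.
apply: planeP; rewrite !(xcoZ, ycoZ, xco_pt, yco_pt); last by ring.
transitivity (prod_c m x * (a (iter m Phi x) * slope (iter m Phi x) + b (iter m Phi x))).
  by ring.
by rewrite slopeE ?mulrA//; exact: S_iter.
Qed.

Let DiffE (g : plane R -> plane R) x v : Diff g x v = 'd g x v.
Proof. by rewrite /Diff lfunE. Qed.

Let decomp x v : v = (xco v - yco v * slope x) *: horiz + yco v *: stab x.
Proof.
by apply: planeP; rewrite /horiz /stab !(xcoD, ycoD, xcoZ, ycoZ, xco_pt, yco_pt); ring.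
Qed.

Let prod_a_neq0 x m : S x -> prod_a m x != 0.
Proof. by move=> Sx; apply/prodf_neq0 => k _; exact/a_neq0/S_iter. Qed.

Let prod_c_neq0 x m : S x -> prod_c m x != 0.
Proof. by move=> Sx; apply/prodf_neq0 => k _; exact/c_neq0/S_iter. Qed.

Let lker_Diff x m : S x -> lker (Diff (iter m Phi) x) = 0%VS.
Proof.
move=> Sx; have [_ h1 h2] := diff_iter m Sx.
apply/eqP; rewrite -subv0; apply/subvP => v; rewrite memv_ker memv0 DiffE.
rewrite [X in 'd _ _ X](decomp x).
rewrite linearD [X in X + _]linearZ [X in _ + X]linearZ /= h1 h2 => /eqP h0.
have hy : yco v = 0.
  have /eqP := congr1 (@yco R) h0.
  rewrite !(ycoD, ycoZ, yco_pt, yco0) mulr0 mulr0 add0r mulr1 mulf_eq0.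
  by rewrite (negPf (prod_c_neq0 m Sx)) orbF => /eqP.
have hx : xco v = 0.
  have := congr1 (@xco R) h0; rewrite hy !(xcoD, xcoZ, xco_pt, xco0) => h.
  have : xco v * prod_a m x = 0 by rewrite -h; ring.
  by move/eqP; rewrite mulf_eq0 (negPf (prod_a_neq0 m Sx)) orbF => /eqP.
by apply/eqP/planeP; rewrite ?hx ?hy ?xco0 ?yco0.
Qed.

Let enormZ (r : R) v : enorm (r *: v) = `|r| * enorm v.
Proof.
rewrite /enorm (_ : dotp _ _ = r ^+ 2 * dotp v v); last first.
  by rewrite /dotp !(xcoZ, ycoZ); ring.
by rewrite sqrtrM ?sqr_ge0// sqrtr_sqr.
Qed.

Let vline_scale (r : R) v : r != 0 -> (<[r *: v]> = <[v]>)%VS.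
Proof.
move=> r0; apply/eqP; rewrite eqEsubv -!memvE memvZ ?memv_line//=.
by apply/vlineP; exists r^-1; rewrite scalerA mulVf// scale1r.
Qed.

Let stab_neq0 x : stab x != 0.
Proof.
by apply/eqP => /(congr1 (@yco R)); rewrite yco_pt yco0; apply/eqP; exact: oner_neq0.
Qed.

Let horiz_neq0 : horiz != 0.
Proof.
by apply/eqP => /(congr1 (@xco R)); rewrite xco_pt xco0; apply/eqP; exact: oner_neq0.
Qed.

Let enorm_stab_ge1 x : 1 <= enorm (stab x).
Proof.
rewrite /enorm -[leLHS]sqrtr1 ler_sqrt /dotp !(xco_pt, yco_pt) mulr1 -expr2.
  by rewrite lerDr sqr_ge0.
by rewrite addr_ge0 ?sqr_ge0.
Qed.

Let enorm_stab_le x : S x -> enorm (stab x) <= K + 1.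
Proof.
move=> Sx; have h := slope_le Sx; have K0 : 0 <= K := le_trans (normr_ge0 _) h.
rewrite /enorm -[leRHS](ger0_norm (addr_ge0 K0 ler01)) -sqrtr_sqr ler_sqrt ?sqr_ge0//.
rewrite /dotp !(xco_pt, yco_pt) mulr1 -expr2 sqrrD mulr1 expr1n lerD2r.
rewrite -real_normK ?num_real// (@le_trans _ _ (K ^+ 2))//.
  by rewrite ler_pXn2r ?nnegrE.
by rewrite lerDl mulrn_wge0.
Qed.

(** The horizontal line field is invariant and expanded, at the rate of the products of
    [a]. The vertical factor [c] is the action on the quotient by this field: it is the
    exact contraction factor of any invariant transverse field, and the series above
    provides one whose slope is continuous and bounded. *)
Theorem triangular_hyperbolic : uniformly_hyperbolic Phi S.
Proof.
split.
  by move=> x Sx; split; [have [] := S_diff Sx | exact: (lker_Diff 1 Sx)].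
exists (fun x => <[stab x]>%VS), (fun=> <[horiz]>%VS); split.
- split.
  + move=> x Sx; rewrite -!subv0 -!memvE !memv0.
    by rewrite stab_neq0 horiz_neq0.
  + move=> x Sx; split; apply/vspaceP => v.
      rewrite memvf (decomp x v) addrC.
      by apply: memv_add; apply: memvZ; exact: memv_line.
    rewrite memv0; apply/memv_capP/eqP => [[/vlineP[r ->] /vlineP[r' e]]|->].
      have /(congr1 (@yco R)) := e.
      rewrite !(ycoZ, yco_pt) mulr0 mulr1 => ->.
      by rewrite scale0r.
    by rewrite !mem0v.
  + move=> x Sx; exists setT, stab; split => //; first exact: openT.
      apply/subspace_continuousP => y [_ Sy].
      apply: cvg_pt; last exact: cvg_cst.
      apply/cvgrPdist_lt => e e0; rewrite near_withinE.
      by apply: filterS (slope_cont Sy e0) => z hz [_ Sz]; exact: hz.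
  + move=> x Sx; exists setT, (fun=> horiz); split => //; first exact: openT.
    by apply: continuous_subspaceT; exact: cst_continuous.
- move=> x Sx; have [_ h1 h2] := diff_iter 1 Sx.
  rewrite !limg_line !DiffE h1 h2.
  by rewrite !vline_scale ?prod_a_neq0 ?prod_c_neq0.
have [Se|/set0P[x0 Sx0]] := eqVneq S set0.
  by exists 2^-1, 1; split => //; [lra | rewrite Se].
have K0 : 0 <= K := le_trans (normr_ge0 _) (slope_le Sx0).
exists (Num.max L rho^-1), (K + 1 + k0^-1); split.
- rewrite lt_max L_gt0/= gt_max L_lt1/=.
  by rewrite invf_lt1.
- by rewrite addr_gt0 ?invr_gt0// ltr_wpDl.
move=> x m Sx _; have Sm := S_iter m Sx; have [_ h1 h2] := diff_iter m Sx.
have k0V : 0 <= k0^-1 by rewrite invr_ge0 ltW.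
split=> [_ /vlineP[r ->]|_ /vlineP[r ->]].
  rewrite DiffE linearZ /= h2 scalerA !enormZ normrM.
  have hc : `|prod_c m x| <= L ^+ m.
    rewrite normr_prod -[leRHS](_ : \prod_(k < m) L = _); last by rewrite prodr_const card_ord.
    by apply: ler_prod => k _; rewrite normr_ge0 c_le//; exact: S_iter.
  rewrite -[leLHS]mulrA [leRHS]mulrCA ler_wpM2l//.
  apply: (@le_trans _ _ (L ^+ m * (K + 1))); first by rewrite ler_pM ?enorm_stab_le ?sqrtr_ge0.
  rewrite (@le_trans _ _ (L ^+ m * (K + 1 + k0^-1)))//.
    by rewrite ler_wpM2l ?exprn_ge0 ?lerDl// ltW.
  rewrite [leLHS]mulrC -mulrA ler_wpM2l ?addr_ge0//.
  rewrite -[leLHS]mulr1 ler_pM ?exprn_ge0 ?(ltW L_gt0)//.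
  by rewrite lerXn2r ?nnegrE ?le_max ?lexx ?(ltW L_gt0).
have -> : r *: horiz = Diff (iter m Phi) x ((r / prod_a m x) *: horiz).
  by rewrite DiffE linearZ /= h1 scalerA divfK// prod_a_neq0.
rewrite lker0_lfunK; last by rewrite lker_Diff.
rewrite DiffE linearZ /= h1 scalerA divfK ?prod_a_neq0// !enormZ mulrA.
rewrite ler_wpM2r ?sqrtr_ge0// normrM mulrC ler_wpM2r// normfV.
have hm := a_growth m Sx; rewrite -normr_prod -/(prod_a m x) in hm.
apply: (@le_trans _ _ (k0^-1 * rho ^- m)).
  rewrite -invfM lef_pV2 ?posrE ?normr_gt0 ?prod_a_neq0//.
  by rewrite mulr_gt0// exprn_gt0.
rewrite ler_pM ?invr_ge0 ?exprn_ge0 ?(ltW rho_gt0) ?(ltW k0_gt0)//.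
  by rewrite lerDr addr_ge0.
by rewrite -exprVn lerXn2r ?nnegrE ?le_max ?lexx ?invr_ge0 ?(ltW rho_gt0) ?orbT.
Qed.

End Triangular.

(** * Contracting reflection laws *)

Section Law.
Context {R : realType}.
Variables (f : R -> R) (k : nat).
Hypothesis k_ge1 : (1 <= k)%N.
Hypothesis hf : contracting_law k f.
Implicit Types (a b t : R).

Lemma angles0 : angles (0 : R).
Proof. by rewrite /angles /= in_itv /= oppr_lt0 divr_gt0 ?pi_gt0. Qed.

Lemma angles_norm a : angles a <-> `|a| < pi / 2.
Proof. by rewrite /angles /= in_itv /= ltr_norml. Qed.

Lemma law_derivable a : angles a -> derivable f a 1.
Proof. by case: hf => -[h _ _] _ _; exact: h. Qed.

Lemma law_derive_continuous a : angles a -> {for a, continuous (derive1 f)}.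
Proof. by case: hf => _ [[_ h] _ _] _ ha; have := h 1 a k_ge1 ha; rewrite derive1n1. Qed.

Lemma law_derive_neq0 a : angles a -> derive1 f a != 0.
Proof. by case: hf => _ [_ h _] _; exact: h. Qed.

Lemma law_lipschitz : exists L : R, [/\ 0 < L, L < 1 &
  forall a, angles a -> `|derive1 f a| <= L].
Proof.
case: hf => _ _; rewrite /lambda; set A := [set _ | _ in _] => h.
have ub a : angles a -> ((`|derive1 f a|)%:E <= ereal_sup A)%E.
  by move=> ha; apply: ereal_sup_ubound; exists a.
have := ub _ angles0; case: (ereal_sup A) h ub => [r| |] // h ub _.
(* the maximum makes the bound positive without evaluating the supremum *)
exists (Num.max r 2^-1); rewrite lt_max gt_max invr_gt0 ltr0n orbT invf_lt1// ltr1n andbT.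
split=> // a /ub; rewrite lee_fin le_max => ->//.
Qed.

Lemma law_contracts (L : R) : (forall a, angles a -> `|derive1 f a| <= L) ->
  forall a, angles a -> `|f a| <= L * `|a|.
Proof.
move=> hL a ha; have f0 : f 0 = 0 by case: hf => -[].
have mvt (u v : R) : angles u -> angles v -> u <= v -> `|f v - f u| <= L * (v - u).
  move=> /angles_norm hu /angles_norm hv uv.
  have sub x : x \in `[u, v] -> angles x.
    rewrite in_itv /= => /andP[ux xv]; apply/angles_norm.
    by move: hu hv; rewrite !ltr_norml => /andP[? ?] /andP[? ?]; apply/andP; lra.
  have [||c cuv ->] := @MVT_segment R f (derive1 f) u v uv.
  - move=> x xuv; rewrite derive1E; apply/derivableP/law_derivable/sub.
    exact: subset_itv_oo_cc xuv.
  - apply: derivable_within_continuous => x xuv.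
    exact/law_derivable/sub.
  rewrite normrM (ger0_norm (_ : 0 <= v - u)) ?subr_ge0//.
  by rewrite ler_wpM2r ?subr_ge0//; apply/hL/sub.
have [a0|a0] := leP 0 a.
  by have := mvt 0 a angles0 ha a0; rewrite f0 !subr0 (ger0_norm a0).
have := mvt a 0 ha angles0 (ltW a0).
by rewrite f0 !sub0r normrN (ltr0_norm a0).
Qed.

End Law.

Section Cosines.
Context {R : realType}.
Implicit Types (a b t L : R).

Lemma cos_le a b : 0 <= a -> a <= b -> b <= pi -> cos b <= cos a.
Proof.
move=> a0 ab bp; rewrite leNgt ltr_cos ?in_itv/= ?a0 ?bp ?(le_trans a0 ab) ?(le_trans ab bp)//.
by rewrite -leNgt.
Qed.

Lemma pihalf_le_pi : pi / 2 <= pi :> R.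
Proof. by have := @pi_ge0 R; lra. Qed.

Lemma norm_sin_ge a (s : R) : 0 < s < 1 -> angles a -> s <= `|sin a| -> asin s <= `|a|.
Proof.
move=> /andP[s0 s1] /angles_norm ha hs.
have s1' : -1 <= s <= 1 by lra.
have /andP[h1 h2] : - (pi / 2) <= asin s <= pi / 2 by rewrite asin_geNpi2 ?asin_lepi2.
have na : `|a| \in `[- (pi / 2), pi / 2].
  by rewrite in_itv /= (ltW ha) andbT (le_trans _ (normr_ge0 a))// oppr_le0 divr_ge0 ?pi_ge0.
rewrite leNgt -ltr_sin// ?in_itv/= ?h1 ?h2// asinK ?in_itv//= -leNgt.
apply: (le_trans hs).
have [a0|a0] := leP 0 a.
  rewrite (ger0_norm a0) in ha *; rewrite ger0_norm// sin_ge0_pi// a0 /=.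
  by rewrite (le_trans (ltW ha))// pihalf_le_pi.
rewrite (ltr0_norm a0) in ha *; rewrite sinN -normrN ger0_norm//.
rewrite -sinN sin_ge0_pi// oppr_ge0 (ltW a0)/=.
by rewrite (le_trans (ltW ha))// pihalf_le_pi.
Qed.

(** Write [`|b|] as [L * `|b| + (1 - L) * `|b|] and drop the product of sines in the
    addition formula. *)
Lemma cos_gain L t b (d : R) : 0 < L -> L < 1 -> angles b -> `|t| <= L * `|b| ->
  0 <= d -> d <= `|b| -> cos b <= cos t * cos ((1 - L) * d).
Proof.
move=> L0 L1 /angles_norm hb ht d0 db.
have p0 := @pi_gt0 R; have pp := pihalf_le_pi.
rewrite -(cos_norm b) -(cos_norm t); set B := `|b| in hb ht db *.
have B0 : 0 <= B by exact: normr_ge0.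
have LB : L * B <= B by rewrite ler_piMl// ltW.
have LB0 : 0 <= L * B by rewrite mulr_ge0// ltW.
have MB : (1 - L) * B <= B by rewrite ler_piMl//; lra.
have MB0 : 0 <= (1 - L) * B by rewrite mulr_ge0//; lra.
have Md0 : 0 <= (1 - L) * d by rewrite mulr_ge0//; lra.
have MdB : (1 - L) * d <= (1 - L) * B by rewrite ler_wpM2l//; lra.
have -> : B = L * B + (1 - L) * B by ring.
rewrite cosD.
have s1 : 0 <= sin (L * B) by apply: sin_ge0_pi; lra.
have s2 : 0 <= sin ((1 - L) * B) by apply: sin_ge0_pi; lra.
have c1 : cos (L * B) <= cos `|t| by apply: cos_le => //; lra.
have c2 : cos ((1 - L) * B) <= cos ((1 - L) * d) by apply: cos_le => //; lra.
have c3 : 0 <= cos (L * B) by apply: cos_ge0_pihalf; lra.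
have c4 : 0 <= cos ((1 - L) * B) by apply: cos_ge0_pihalf; lra.
apply: (@le_trans _ _ (cos (L * B) * cos ((1 - L) * B))).
  by rewrite gerBl mulr_ge0.
exact: ler_pM.
Qed.

End Cosines.

(** * Products along orbits *)

Section OrbitProducts.
Context {R : realType} {T : Type}.
Variables (F : T -> T) (S : set T) (g : T -> R).
Hypothesis S_forward : forall x, S x -> S (F x).
Hypothesis g_ge1 : forall x, S x -> 1 <= g x.
Implicit Types (x : T) (l q N W : nat).

Lemma orbit_forward x N : S x -> S (iter N F x).
Proof. by move=> Sx; elim: N => //= N; exact: S_forward. Qed.

Lemma prod_orbit_split x N1 N2 :
  \prod_(l < (N1 + N2)%N) g (iter l F x) =
  (\prod_(l < N1) g (iter l F x)) * \prod_(l < N2) g (iter l F (iter N1 F x)).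
Proof.
elim: N2 => [|N IH]; first by rewrite addn0 big_ord0 mulr1.
by rewrite addnS !big_ord_recr /= IH mulrA -iterD addnC.
Qed.

Lemma prod_orbit_ge1 x N : S x -> 1 <= \prod_(l < N) g (iter l F x).
Proof.
move=> Sx; elim: N => [|N IH]; first by rewrite big_ord0.
by rewrite big_ord_recr /= mulr_ege1//; apply/g_ge1/orbit_forward.
Qed.

Lemma prod_orbit_ge_factor x q W (rho : R) : S x -> (q < W)%N -> 0 <= rho ->
  rho <= g (iter q F x) -> rho <= \prod_(l < W) g (iter l F x).
Proof.
move=> Sx qW r0 hq; have -> : W = (q.+1 + (W - q.+1))%N by rewrite subnKC.
rewrite prod_orbit_split [X in _ <= X * _]big_ord_recr /=.
have h3 : rho <= \prod_(l < q) g (iter l F x) * g (iter q F x).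
  apply: (le_trans hq); apply: ler_peMl; first exact: le_trans r0 hq.
  exact: prod_orbit_ge1.
apply: (le_trans h3); apply: ler_peMr; first exact: le_trans r0 h3.
exact: prod_orbit_ge1 (orbit_forward q.+1 Sx).
Qed.

(** A fixed gain on each window of length [W] gives a rate, the [W]-th root of the
    gain, up to the factor lost in the last incomplete window. *)
Lemma prod_orbit_growth W (rho0 : R) : (0 < W)%N -> 1 < rho0 ->
    (forall x, S x -> rho0 <= \prod_(l < W) g (iter l F x)) ->
  exists k0 rho : R, [/\ 0 < k0, 1 < rho &
    forall x N, S x -> k0 * rho ^+ N <= \prod_(l < N) g (iter l F x)].
Proof.
move=> W0 rho1 hW; have p0 : 0 < rho0 := lt_trans ltr01 rho1.
have W0' : 0 < W%:R :> R by rewrite ltr0n.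
pose rho := expR (ln rho0 / W%:R).
have rhoW : rho ^+ W = rho0.
  by rewrite -expRM_natl mulrCA divff ?mulr1 ?gt_eqF// lnK.
have rho_gt1 : 1 < rho by rewrite -expR0 ltr_expR divr_gt0// ln_gt0.
exists rho0^-1, rho; split => //; first by rewrite invr_gt0.
move=> x N Sx.
have windows q : rho0 ^+ q <= \prod_(l < (q * W)%N) g (iter l F x).
  elim: q => [|q IH]; first by rewrite mul0n big_ord0 expr0.
  rewrite mulSn addnC prod_orbit_split exprSr.
  apply: ler_pM; [exact: exprn_ge0 (ltW p0) | exact: ltW | exact: IH |].
  exact/hW/orbit_forward.
have -> : \prod_(l < N) g (iter l F x) =
    \prod_(l < (N %/ W * W + N %% W)%N) g (iter l F x) by rewrite -divn_eq.
rewrite prod_orbit_split.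
apply: (@le_trans _ _ (rho0 ^+ (N %/ W))).
  rewrite ler_pdivrMl// -exprS -rhoW -exprM.
  by rewrite ler_eXn2l// mulnC ltnW// ltn_ceil.
apply: (le_trans (windows _)); apply: ler_peMr.
  exact: le_trans (exprn_ge0 _ (ltW p0)) (windows _).
exact/prod_orbit_ge1/orbit_forward.
Qed.

End OrbitProducts.

(** * Expansion along the orbits *)

Section Expansion.
Context {R : realType} {n : nat} (C : 'I_n -> plane R).
Hypothesis hC : simple_polygon C.
Hypothesis hpos : positively_oriented C.
Variables (f : R -> R) (k : nat).
Hypothesis k_ge1 : (1 <= k)%N.
Hypothesis hf : contracting_law k f.
Variable Sigma : set (plane R).
Hypothesis hinv : billiard_invariant C f Sigma.
Hypothesis hA : property_A C f Sigma.
Implicit Types (i j : 'I_n) (x y : plane R) (m l N : nat).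

Local Notation Phi := (billiard C f).

Lemma invariant_dom x : Sigma x -> billiard_dom C x.
Proof. by case: hinv => _ <- []. Qed.

Lemma invariant_forward x : Sigma x -> Sigma (Phi x).
Proof. by move=> Sx; case: hA => -[_ h] _; apply: h; exists x. Qed.

Lemma invariant_preimage x : Sigma x -> exists2 y, billiard_dom C y & Phi y = x.
Proof.
move=> Sx; case: hinv => /(_ x Sx) /(_ 1%N I) [y [hy ny] <-] _; exists y => //.
by split => // h; apply: ny; exists 1%N.
Qed.

(** The entries of the triangular differential, written without reference to the two
    sides, so as to be functions on the phase space. *)
Definition landing_speed x : R := dotp (perp (tangent1 C x)) (bv C x).
Definition horizontal_factor x : R := cos (yco x) / landing_speed x.
Definition shear x : R := bt C x / landing_speed x.
Definition vertical_factor x : R := derive1 f (btheta1 C x) * Num.sg (landing_speed x).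

Lemma landing_speedE i j x : leaves_lands C i j x -> bt C x = hit_time C i j x ->
  landing_speed x = nspeed C i j (yco x).
Proof.
move=> hx et; rewrite /landing_speed (tangent1E hC hx et).
by case: hx => hs _ _ _ _; rewrite (bvE hC hs).
Qed.

Lemma billiard_is_diff x : billiard_dom C x ->
  is_diff x Phi (fun v => pt (horizontal_factor x * xco v + shear x * yco v)
                             (vertical_factor x * yco v)).
Proof.
move=> /(flight_between hC hpos)[i [j [hx et]]].
apply: (is_diff_eq (is_diff_billiard hC hpos (law_derivable hf) hx et)).
apply/funext => v; rewrite /horizontal_factor /shear /vertical_factor.
rewrite (landing_speedE hx et) (btheta1E hC hx et) et; congr pt.
by rewrite mulrDl -!mulrA ![_ * (nspeed _ _ _ _)^-1]mulrC.
Qed.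

Lemma near_eq_continuous (g h : plane R -> R) x :
  (\forall y \near x, h y = g y) -> {for x, continuous h} -> {for x, continuous g}.
Proof.
move=> e hc; have ex : h x = g x by exact: nbhs_singleton e.
rewrite /prop_for /continuous_at -ex; apply: cvg_trans hc.
exact: (near_eq_cvg e).
Qed.

Lemma factors_continuous x : billiard_dom C x ->
  [/\ {for x, continuous horizontal_factor}, {for x, continuous shear}
    & {for x, continuous vertical_factor}].
Proof.
move=> /(flight_between hC hpos)[i [j [hx et]]]; have [_ _ _ _ H0] := hx.
have nr := flight_near hC hpos hx et.
have FF : Filter (nbhs x) := nbhs_filter x.
have cn : {for x, continuous (fun y => nspeed C i j (yco y))}.
  exact: (cvg_nspeed cvg_id).
have cy : {for x, continuous (@yco R)} by exact: continuous_yco.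
split.
- apply: (@near_eq_continuous _ (fun y => cos (yco y) * (nspeed C i j (yco y))^-1)).
    by apply: filterS nr => y [hy ety]; rewrite /horizontal_factor (landing_speedE hy ety).
  apply: continuousM; last exact: continuousV.
  apply: (@continuous_comp _ _ _ (@yco R) cos) => //; exact: continuous_cos.
- apply: (@near_eq_continuous _ (fun y => hit_time C i j y * (nspeed C i j (yco y))^-1)).
    by apply: filterS nr => y [hy ety]; rewrite /shear (landing_speedE hy ety) ety.
  apply: continuousM; last exact: continuousV.
  exact: (cvg_hit_time cvg_id H0).
apply: (@near_eq_continuous _ (fun y => derive1 f (asin (tspeed C i j (yco y))) *
    (nspeed C i j (yco y) * `|nspeed C i j (yco y)|^-1))).
  apply: filterS nr => y [hy ety].
  rewrite /vertical_factor (landing_speedE hy ety) (btheta1E hC hy ety).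
  have [_ _ _ _ Hy] := hy; congr (_ * _).
  by rewrite {1}[nspeed C i j (yco y)]numEsg mulfK// normr_eq0.
apply: continuousM.
  apply: (@continuous_comp _ _ _ (fun y => asin (tspeed C i j (yco y))) (derive1 f)).
    apply: (@continuous_comp _ _ _ (fun y => tspeed C i j (yco y)) asin).
      exact: (cvg_tspeed cvg_id).
    by apply: continuous_asin; exact: (tspeed_bound hC H0).
  by apply: (law_derive_continuous k_ge1 hf); exact: asin_tspeed_angle.
apply: continuousM => //; apply: continuousV; first by rewrite normr_eq0.
by apply: (@continuous_comp _ _ _ (fun y => nspeed C i j (yco y))
  (fun r : R => `|r|)) => //; exact: norm_continuous.
Qed.

Lemma btheta1_angle x : billiard_dom C x -> angles (btheta1 C x).
Proof.
move=> /(flight_between hC hpos)[i [j [hx et]]]; rewrite (btheta1E hC hx et).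
by apply: (asin_tspeed_angle hC); case: hx.
Qed.

Lemma yco_billiard x : yco (Phi x) = f (btheta1 C x).
Proof. exact: yco_pt. Qed.

Lemma cos_btheta1 x : billiard_dom C x ->
  0 < cos (btheta1 C x) /\ `|landing_speed x| = cos (btheta1 C x).
Proof.
move=> dx; split; first exact/cos_angle/btheta1_angle.
move: dx => /(flight_between hC hpos)[i [j [hx et]]].
rewrite (landing_speedE hx et) (btheta1E hC hx et) cos_asin_tspeed//.
by case: hx.
Qed.

Lemma landing_speed_neq0 x : billiard_dom C x -> landing_speed x != 0.
Proof. by move=> /cos_btheta1[h e]; rewrite -normr_gt0 e. Qed.

Variable L : R.
Hypothesis L_gt0 : 0 < L.
Hypothesis L_lt1 : L < 1.
Hypothesis L_bound : forall a, angles a -> `|derive1 f a| <= L.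

Let theta_le x : billiard_dom C x -> `|yco (Phi x)| <= L * `|btheta1 C x|.
Proof.
by move=> dx; rewrite yco_billiard; apply: (law_contracts hf L_bound); exact: btheta1_angle.
Qed.

Let C0 : R := cos (L * (pi / 2)).

Let C0_gt0 : 0 < C0.
Proof.
have p0 := @pi_gt0 R; have h : L * (pi / 2) < pi / 2 by rewrite gtr_pMl// divr_gt0.
apply: cos_gt0_pihalf; rewrite h andbT.
by rewrite (@lt_le_trans _ _ 0) ?oppr_lt0 ?divr_gt0// mulr_ge0 ?divr_ge0 ?ltW.
Qed.

(* Every collision of the invariant set comes after a reflection, so that its angle
   stays away from the grazing directions. *)
Let cos_yco_ge x : Sigma x -> C0 <= cos (yco x).
Proof.
move=> /invariant_preimage[y dy <-]; rewrite -(cos_norm (yco _)).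
have p0 := @pi_gt0 R; have hb := (angles_norm _).1 (btheta1_angle dy).
have h : L * (pi / 2) <= pi / 2 by rewrite ler_piMl ?divr_ge0// ltW.
have h' : L * `|btheta1 C y| <= L * (pi / 2) by apply: ler_wpM2l; apply: ltW.
apply: cos_le => //; first exact: le_trans (theta_le dy) h'.
by apply: (le_trans h); exact: pihalf_le_pi.
Qed.

(** The part of the horizontal expansion due to the reflection itself; it is at least 1
    because the law brings the trajectory closer to the normal. *)
Definition reflection_gain x : R := cos (yco (Phi x)) / cos (btheta1 C x).

Let gain_ge1 x : billiard_dom C x -> 1 <= reflection_gain x.
Proof.
move=> dx; have [c0 _] := cos_btheta1 dx.
rewrite /reflection_gain ler_pdivlMr// mul1r.
have := cos_gain L_gt0 L_lt1 (btheta1_angle dx) (theta_le dx) (lexx 0) (normr_ge0 _).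
by rewrite mulr0 cos0 mulr1.
Qed.

(* The cosines of the outgoing angles telescope along an orbit. *)
Let norm_horizontal_factor x : Sigma x ->
  `|horizontal_factor x| * cos (yco (Phi x)) = cos (yco x) * reflection_gain x.
Proof.
move=> Sx; have [c0 e] := cos_btheta1 (invariant_dom Sx).
rewrite /horizontal_factor /reflection_gain normrM normfV e.
by rewrite (gtr0_norm (lt_le_trans C0_gt0 (cos_yco_ge Sx))) mulrAC -mulrA.
Qed.

Let prod_horizontal x N : Sigma x ->
  (\prod_(l < N) `|horizontal_factor (iter l Phi x)|) * cos (yco (iter N Phi x)) =
  cos (yco x) * \prod_(l < N) reflection_gain (iter l Phi x).
Proof.
move=> Sx; elim: N => [|N IH]; first by rewrite !big_ord0 mul1r mulr1.
have SN := orbit_forward invariant_forward N Sx.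
rewrite 2!big_ord_recr /= mulrA -IH -!mulrA; congr (_ * _).
exact: norm_horizontal_factor.
Qed.

(** There are finitely many pairs of sides. *)
Lemma nonparallel_gap : exists kap : R, [/\ 0 < kap, kap <= 1 &
  forall i j, ~ parallel_sides C i j ->
    kap <= `|dotp (tang C j) (perp (tang C i))|].
Proof.
pose g (p : 'I_n * 'I_n) := `|dotp (tang C p.2) (perp (tang C p.1))|.
exists (\big[Num.min/1]_(p | `[< ~ parallel_sides C p.1 p.2 >]) g p); split.
- apply: lt_bigmin => // -[i j] /asboolP /= np; rewrite /g /= normr_gt0.
  apply/negP => /eqP h; apply: np.
  have e : dotp (tang C i) (perp (tang C j)) = 0.
    by rewrite -oppr0 -h /dotp /perp !(xco_pt, yco_pt); ring.
  exists (side_len C i * dotp (tang C i) (tang C j) / side_len C j).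
  rewrite (side_vecE hC i) (side_vecE hC j).
  rewrite {1}(frame_decomp (tang C i) (dotp_tang hC j)) e scale0r addr0 !scalerA.
  by rewrite divfK// gt_eqF// side_len_gt0.
- by apply: bigmin_le_id.
- by move=> i j np; apply: (bigmin_le_cond 1 g (j := (i, j))); exact/asboolP.
Qed.

Lemma tang_dotp_le1 i j : `|dotp (tang C j) (tang C i)| <= 1.
Proof.
rewrite -(@ler_pXn2r _ 2) ?nnegrE// expr1n real_normK ?num_real//.
have : dotp (tang C j) (tang C i) ^+ 2 + dotp (tang C j) (perp (tang C i)) ^+ 2 =
    dotp (tang C j) (tang C j) * dotp (tang C i) (tang C i).
  by rewrite /dotp /perp !(xco_pt, yco_pt); ring.
rewrite !dotp_tang// mulr1 => <-.
by rewrite lerDl sqr_ge0.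
Qed.

Lemma collides_ends i j x : leaves_lands C i j x -> bt C x = hit_time C i j x ->
  collides_at C x i /\ collides_at C (Phi x) j.
Proof.
move=> hx et; have [hs _ _ hp _] := hx.
have [h1 h2] := andP hs; have [h3 h4] := andP hp.
split; rewrite /collides_at.
  by rewrite (bqE hC hs); apply: (mem_side hC); rewrite !ltW.
rewrite /bq (billiardE hC f hx et) xco_pt (zetaE hC (i := j)) ?(ltW h3) ?(ltW h4)//.
by apply: (mem_side hC); rewrite !ltW.
Qed.

(* On a flight between sides that are not parallel, the angles at both ends cannot
   both be close to the normal direction; and the reflection gain is bounded away from 1
   when the arrival angle is bounded away from 0. *)
Let nonparallel_gain : exists2 rho0 : R, 1 < rho0 & forall x, Sigma x ->
  ~ (exists i j, [/\ collides_at C (Phi x) i, collides_at C (Phi (Phi x)) j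
                   & parallel_sides C i j]) ->
  rho0 <= reflection_gain x \/ rho0 <= reflection_gain (Phi x).
Proof.
have [kap [kap0 kap1 hkap]] := nonparallel_gap.
have C01 : C0 <= 1 by exact: cos_le1.
(* the sines of the two angles add up to at least [kap * C0] *)
pose s := kap * C0 / 2.
have kC : kap * C0 <= 1 by apply: mulr_ile1 => //; exact: ltW.
have s0 : 0 < s by rewrite divr_gt0// mulr_gt0.
have s1 : s < 1 by rewrite /s; lra.
pose d := asin s.
have dI : -1 <= s <= 1 by lra.
have sd : sin d = s by apply: asinK; rewrite in_itv /= dI.
have d2 : d < pi / 2 by apply: asin_ltpi2; lra.
have d0 : 0 < d.
  have := asin_geNpi2 dI; rewrite -/d => d1.
  rewrite ltNge; apply/negP => dle.
  have : 0 <= sin (- d) by apply: sin_ge0_pi; have := @pihalf_le_pi R; lra.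
  by rewrite sinN sd; lra.
have M0 : 0 < (1 - L) * d by rewrite mulr_gt0// subr_gt0.
have Md : (1 - L) * d <= d by apply: ler_piMl; [exact: ltW | rewrite gerBl ltW].
have p2 := @pihalf_le_pi R; have p0 := @pi_gt0 R.
have c0 : 0 < cos ((1 - L) * d) by apply: cos_gt0_pihalf; lra.
have c1 : cos ((1 - L) * d) < 1.
  by rewrite -[ltRHS]cos0 ltr_cos// in_itv /=; lra.
exists (cos ((1 - L) * d))^-1; first by rewrite invf_gt1.
have gain x : billiard_dom C x -> d <= `|btheta1 C x| ->
    (cos ((1 - L) * d))^-1 <= reflection_gain x.
  move=> dx hd; have [cb _] := cos_btheta1 dx.
  rewrite /reflection_gain ler_pdivlMr// ler_pdivrMl//.
  rewrite mulrC; apply: cos_gain => //; [exact: btheta1_angle | exact: theta_le | exact: ltW].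
move=> x Sx np; have Sy := invariant_forward Sx.
have dx := invariant_dom Sx; have dy := invariant_dom Sy.
have [i [j [hy et]]] := flight_between hC hpos dy.
have nij : ~ parallel_sides C i j.
  by move=> h; have [ci cj] := collides_ends hy et; apply: np; exists i, j.
set y := Phi x in Sy dy hy et *.
have H0 : nspeed C i j (yco y) != 0 by case: hy.
have eb : sin (btheta1 C y) = tspeed C i j (yco y).
  rewrite (btheta1E hC hy et) asinK// in_itv /=.
  by have /andP[? ?] := tspeed_bound hC H0; rewrite !ltW.
have sum : 2 * s <= `|sin (btheta1 C y)| + `|sin (yco y)|.
  have h1 : kap * C0 <= `|dotp (tang C j) (perp (tang C i)) * cos (yco y)|.
    rewrite normrM; apply: ler_pM; [exact: ltW | exact: ltW | exact: hkap |].
    exact: le_trans (cos_yco_ge Sy) (ler_norm _).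
  have h2 : `|dotp (tang C j) (tang C i) * sin (yco y)| <= `|sin (yco y)|.
    by rewrite normrM ler_piMl// tang_dotp_le1.
  have e : dotp (tang C j) (perp (tang C i)) * cos (yco y) =
      sin (btheta1 C y) - dotp (tang C j) (tang C i) * sin (yco y).
    by rewrite eb (speed_trig C i j (yco y)).1; ring.
  rewrite e in h1; have := ler_normB (sin (btheta1 C y)) (dotp (tang C j) (tang C i) * sin (yco y)).
  by rewrite (_ : 2 * s = kap * C0); [lra | rewrite /s; field].
have [hb|hb] := leP s `|sin (btheta1 C y)|.
  right; apply: gain => //; apply: norm_sin_ge => //; [by rewrite s0 | exact: btheta1_angle].
left; apply: gain => //.
have ay : angles (yco y) by case: hy.
have ht : d <= `|yco y| by apply: norm_sin_ge => //; [rewrite s0 | lra].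
apply: (le_trans ht); apply: (le_trans (theta_le dx)).
by rewrite ler_piMl// ltW.
Qed.

Let parallel_free_pair x m : Sigma x ->
  (forall y l, parallel_collisions C f Sigma y l -> (l <= m)%N) ->
  exists2 l, (l.+1 < m.+1)%N &
    ~ (exists i j, [/\ collides_at C (Phi (iter l Phi x)) i,
        collides_at C (Phi (Phi (iter l Phi x))) j & parallel_sides C i j]).
Proof.
rewrite /parallel_collisions; move=> Sx hm; apply: contrapT => h.
suff : (m.+1 <= m)%N by rewrite ltnn.
apply: (hm (Phi x)); clear hm.
(* from here on only the iterates matter, not the map *)
move: invariant_forward h Sx; move: Phi => F fwd h Sx.
split=> l hl; first by rewrite -iterSr; exact: orbit_forward.
apply: contrapT => h'; apply: h; exists l => //.
by move: h'; rewrite -iterSr iterS -iterSr !iterS.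
Qed.

(* Among the collisions following [x], property A provides within bounded time a
   flight between sides that are not parallel, at one end of which the reflection has a
   fixed gain. *)
Let window_gain : exists W, (0 < W)%N /\ exists2 rho0 : R, 1 < rho0 &
  forall x, Sigma x -> rho0 <= \prod_(l < W) reflection_gain (iter l Phi x).
Proof.
have [rho0 rho1 hgain] := nonparallel_gain.
have [_ [m m0 hm]] := hA.
exists m.+1; split=> //; exists rho0 => // x Sx.
have gain_S x' : Sigma x' -> 1 <= reflection_gain x' by move=> /invariant_dom/gain_ge1.
have r0 : 0 <= rho0 by rewrite ltW// (lt_trans ltr01).
have [l lm hl] := parallel_free_pair Sx hm.
have ge_factor := prod_orbit_ge_factor invariant_forward gain_S Sx.
have [hr|hr] := hgain _ (orbit_forward invariant_forward l Sx) hl.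
  exact: (ge_factor l m.+1 rho0 (ltnW lm) r0 hr).
exact: (ge_factor l.+1 m.+1 rho0 lm r0 hr).
Qed.

(** Only the cosines of the first and of the last outgoing angles survive besides the
    reflection gains, and both are bounded below. *)
Lemma horizontal_growth : exists k0 rho : R, [/\ 0 < k0, 1 < rho &
  forall x N, Sigma x ->
    k0 * rho ^+ N <= \prod_(l < N) `|horizontal_factor (iter l Phi x)|].
Proof.
have [W [W0 [rho0 rho01 hW]]] := window_gain.
have gain_S x' : Sigma x' -> 1 <= reflection_gain x' by move=> /invariant_dom/gain_ge1.
have [k0 [rho [k00 rho1 h]]] :=
  prod_orbit_growth invariant_forward gain_S W0 rho01 hW.
exists (C0 * k0), rho; split => //; first exact: mulr_gt0.
move=> x N Sx; have e := prod_horizontal N Sx.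
have c1 := cos_le1 (yco (iter N Phi x)).
apply: (@le_trans _ _ (cos (yco x) * \prod_(l < N) reflection_gain (iter l Phi x))).
  rewrite -mulrA; apply: ler_pM; [exact: ltW | | exact: cos_yco_ge | exact: h].
  by rewrite mulr_ge0 ?exprn_ge0 ?ltW// (lt_trans ltr01).
by rewrite -e ler_piMr// prodr_ge0.
Qed.

Lemma shear_ratio_bounded : exists B : R, forall x, Sigma x ->
  `|shear x / horizontal_factor x| <= B.
Proof.
have [M M0 hM] := flight_bounded hC.
exists (M / C0) => x Sx; have dx := invariant_dom Sx.
have [i [j [[hs ax t0 _ _] et]]] := flight_between hC hpos dx.
have [b0 ht _] := flight_end hC hpos hs ax.
have c0 := lt_le_trans C0_gt0 (cos_yco_ge Sx).
have -> : shear x / horizontal_factor x = bt C x / cos (yco x).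
  rewrite /shear /horizontal_factor; field.
  by rewrite (gt_eqF c0) landing_speed_neq0.
rewrite ger0_norm; last by apply: divr_ge0; exact: ltW.
apply: ler_pM.
- exact: ltW.
- by rewrite invr_ge0 ltW.
- exact: (hM i x _ hs b0 ht).
- by rewrite lef_pV2 ?posrE// cos_yco_ge.
Qed.

Lemma vertical_factor_le x : Sigma x -> `|vertical_factor x| <= L.
Proof.
move=> /invariant_dom dx; rewrite /vertical_factor normrM normr_sg.
by rewrite landing_speed_neq0// mulr1 L_bound//; exact: btheta1_angle.
Qed.

Lemma vertical_factor_neq0 x : Sigma x -> vertical_factor x != 0.
Proof.
move=> /invariant_dom dx; rewrite /vertical_factor mulf_neq0 ?sgr_eq0 ?landing_speed_neq0//.
exact/(law_derive_neq0 hf)/btheta1_angle.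
Qed.

Lemma horizontal_factor_neq0 x : Sigma x -> horizontal_factor x != 0.
Proof.
move=> Sx; have dx := invariant_dom Sx; apply: mulf_neq0.
  by rewrite gt_eqF// (lt_le_trans C0_gt0 (cos_yco_ge Sx)).
by rewrite invr_eq0 landing_speed_neq0.
Qed.

End Expansion.

Theorem proposition3p3 (R : realType) (n : nat) (C : 'I_n -> plane R)
    (hC : simple_polygon C) (hpos : positively_oriented C)
    (k : nat) (hk : (1 <= k)%N) (f : R -> R) (hf : contracting_law k f)
    (Sigma : set (plane R)) (hinv : billiard_invariant C f Sigma)
    (hA : property_A C f Sigma) :
  uniformly_hyperbolic (billiard C f) Sigma.
Proof.
have [L [L0 L1 hL]] := law_lipschitz hf.
have [k0 [rho [k00 rho1 growth]]] := horizontal_growth hC hpos hf hinv hA L0 L1 hL.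
have [B hB] := shear_ratio_bounded hC hpos hf hinv L0 L1 hL.
have dom x : Sigma x -> billiard_dom C x by exact: (invariant_dom hinv).
apply: (@triangular_hyperbolic R (billiard C f) Sigma (horizontal_factor C) (shear C)
  (vertical_factor C f) _ _ _ _ _ _ _ L B k0 rho) => //.
- by move=> x; exact: (invariant_forward hA).
- by move=> x /dom dx; exact: (billiard_is_diff hC hpos hf dx).
- by move=> x /dom/(factors_continuous hC hpos hk hf)[].
- by move=> x /dom/(factors_continuous hC hpos hk hf)[].
- by move=> x /dom/(factors_continuous hC hpos hk hf)[].
- by move=> x Sx; exact: (horizontal_factor_neq0 hC hpos hf hinv L0 L1 hL Sx).
- by move=> x Sx; exact: (vertical_factor_neq0 hC hpos hf hinv Sx).
- by move=> x Sx; exact: (vertical_factor_le hC hpos hinv hL Sx).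
Qed.
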